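(* Let $d\in\mathbb{N}$ and $L\in\{2,3,\ldots\}$. (i) For every $a>1$ there exists an isometry-invariant kernel $J$ on $\mathbb{H}^d_L$ satisfying $J\sim aL^d n^{-2d}\log\log n$ such that $\mathbb{P}_J(|K_0|=\infty)>0$. (ii) If $J$ is an isometry-invariant kernel on $\mathbb{H}^d_L$ such that \[\limsup_{n\to\infty}\frac{L^{-d}(L^n)^{2d}}{\log\log(L^n)}J(L^n)\le1,\] then $\mathbb{P}_J(|K_0|=\infty)=0$.
   Context: The hierarchical lattice $\mathbb{H}^d_L$ is the group $\bigoplus_{i=1}^\infty(\mathbb{Z}/L\mathbb{Z})^d$ with ultrametric $\|x-y\|=L^{\max\{i:x_i\neq y_i\}}$ for $x\neq y$. Edges are unordered pairs $e=\{x,y\}$ of distinct vertices, with length $|e|=\|x-y\|$. For a kernel $J:E\to[0,\infty)$, $\mathbb{P}_J$ is the law of the random graph where each edge $e$ is open independently with probability $1-\exp(-J(e))$; $K_0$ is the open cluster of the origin. $J$ is isometry-invariant if $J(e)=J(f)$ whenever $|e|=|f|$; such a kernel is regarded as a function on $\{L,L^2,\ldots\}$ via $J(|e|)=J(e)$. For $f:\mathbb{N}\to[0,\infty)$, $J\sim f$ means $\lim_{|e|\to\infty}J(e)/f(|e|)=1$. *)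

(* Defs.v *)
From HB Require Import structures.
From mathcomp Require Import all_boot all_order all_algebra.
From mathcomp Require Import all_classical all_reals all_analysis.
Set Implicit Arguments. Unset Strict Implicit. Unset Printing Implicit Defensive.
Import Order.TTheory GRing.Theory Num.Theory.
Local Open Scope ring_scope.

(* Hierarchical lattice H^d_L.  A vertex is a finitely supported sequence
   (x_1, x_2, ...) of elements of (Z/LZ)^d.  The ball B_n (= {x : x_i = 0 for
   i > n}) is identified with the finite type of n-tuples (x_1,...,x_n);
   the coordinate x_(i+1) is [x i] for i : 'I_n. *)
Definition vert (d L n : nat) : finType := {ffun 'I_n -> {ffun 'I_d -> 'I_L}}.

Definition is_origin (d L n : nat) (x : vert d L n) : bool :=
  [forall i, forall j, nat_of_ord (x i j) == 0%N].

(* level of x,y : max { i (1-based) : x_i <> y_i }, 0 if x = y;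
   so ||x - y|| = L ^ level x y for x <> y. *)
Definition level (d L n : nat) (x y : vert d L n) : nat :=
  \max_(i < n | x i != y i) i.+1.

Definition edge (d L n : nat) : finType :=
  {A : {set vert d L n} | #|A| == 2%N}.

Definition edge_len (d L n : nat) (e : edge d L n) : nat :=
  L ^ (\max_(x in val e) \max_(y in val e) level x y).

Definition config (d L n : nat) : finType := {ffun edge d L n -> bool}.

(* For an isometry-invariant kernel J (given as a function of the edge
   length), edge e is open with probability 1 - exp(-J(|e|)). *)
Definition open_prob (R : realType) (d L n : nat) (J : nat -> R)
  (e : edge d L n) : R := 1 - expR (- J (edge_len e)).

Definition config_prob (R : realType) (d L n : nat) (J : nat -> R)
  (w : config d L n) : R :=
  \prod_(e : edge d L n)
     (if w e then open_prob J e else 1 - open_prob J e).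

Definition open_adj (d L n : nat) (w : config d L n) : rel (vert d L n) :=
  fun x y => [exists e : edge d L n, [&& x \in val e, y \in val e & w e]].

Definition cluster (d L n : nat) (w : config d L n) : {set vert d L n} :=
  [set y | [exists x, is_origin x && connect (open_adj w) x y]].

Definition prob_cluster_ge (R : realType) (d L : nat) (J : nat -> R)
  (n m : nat) : R :=
  \sum_(w : config d L n | (m <= #|cluster w|)%N) config_prob J w.

(* P_J(|K_0| = infinity).  Since the events {|K_0 cap B_n| >= m} (cluster
   computed with the edges inside B_n) increase in n to {|K_0| >= m}, and the
   latter decrease in m to {|K_0| = oo}, continuity of the measure gives
     P_J(|K_0| = oo) = inf_m sup_n P_J(|K_0 cap B_n| >= m). *)
Definition perc_prob (R : realType) (d L : nat) (J : nat -> R) : R :=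
  inf [set s | exists m : nat,
         s = sup [set p | exists n : nat, p = prob_cluster_ge d L J n m]].

(* Main.v *)
(* Write N = L^d and J_l = J(L^l), so that J_l is about a N^(1-2l) log l.  The
   expected number of edges between a ball of level n and its complement is then
   about a log n, hence such a ball is isolated with probability n^(-a).

   Absence of percolation.  Vertices isolated inside a ball of level n have
   density bounded below, so the other ones ("active") have density at most
   1 - c with high probability, and send no edge out of the ball with
   probability at least n^(-(1-c')) as soon as J_l <= (1+e) N^(1-2l) log l.  There
   are about n / log n scales between n and 2n, which are nearly independent
   since an edge rarely jumps over an annulus of width of order log n; so at one
   of them the active vertices have no outgoing edge, and the cluster of the
   origin stays in the corresponding ball.

   Percolation.  Take J_l = a N^(1-2l) log(lam l) with lam large, and look at the
   levels r k only, with M = N^r large.  The core of a ball is built from the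
   cores of the balls one scale below (the units) that are dense and connected
   inside the next larger ball.  The isoperimetric inequality shows that a cut
   of the ball of scale k+2 that splits a ball of scale k+1 closes edges of total
   weight at least (1-1/M) a log(lam k); since there are only M^2 units, a union
   bound over the cuts gives a failure probability (lam k)^(-b) with b > 1, while a
   bad unit, being rare, leaves room for a cruder bound.  Low density is
   controlled by the variance of the lost fraction, which averaging over M units
   contracts.  The failure probabilities are summable, with a small sum, so the
   origin belongs to all cores with probability at least 1/2. *)
Require Import Defs.
From HB Require Import structures.
From mathcomp Require Import all_boot all_order all_algebra.
From mathcomp Require Import all_classical all_reals all_analysis.
From mathcomp Require Import lra ring zify.
Import Order.TTheory GRing.Theory Num.Theory.
Import numFieldNormedType.Exports.
Import mathcomp.boot.fintype mathcomp.boot.finset.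
Local Open Scope ring_scope.
Set Implicit Arguments. Unset Strict Implicit. Unset Printing Implicit Defensive.

(** * Expectations over finite configurations *)

Section Expectation.
Variables (R : realType) (d L n : nat) (J : nat -> R).
Hypothesis J_ge0 : forall k, (1 <= k)%N -> 0 <= J (L ^ k)%N.
Notation V := (vert d L n).
Notation E := (edge d L n).
Notation C := (config d L n).
Implicit Types (w : C) (e : E) (D F : {set E}).

Definition agree (D : {set E}) (w w' : C) := forall e, e \in D -> w e = w' e.
(** Measurability with respect to the states of the edges of [D]; independence and conditioning are
    expressed through it. *)
Definition depends_on (T : Type) (D : {set E}) (f : C -> T) :=
  forall w w', agree D w w' -> f w = f w'.

Definition Ex (f : C -> R) : R := \sum_(w : C) config_prob J w * f w.
Definition Pr (P : pred C) : R := Ex (fun w => (P w)%:R).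
Definition closed_in (F : {set E}) (w : C) : bool := [forall e in F, ~~ w e].

Lemma eq_Ex f g : f =1 g -> Ex f = Ex g.
Proof. by move=> fg; apply: eq_bigr => w _; rewrite fg. Qed.

Lemma edge_lenE e : exists x y, [/\ x != y, val e = [set x; y] &
  edge_len e = (L ^ level x y)%N].
Proof.
have /cards2P[x [y [xy eE]]] : #|val e| == 2%N := valP e.
exists x, y; split=> //; rewrite /edge_len eE.
have lxx (z : V) : level z z = 0%N.
  by apply/eqP; rewrite -leqn0; apply/bigmax_leqP => i; rewrite eqxx.
have ls (u v : V) : level u v = level v u by apply: eq_bigl => i; rewrite eq_sym.
rewrite big_setU1 ?inE//= big_set1 !big_setU1 ?inE// !big_set1 !lxx (ls y x).
by rewrite /= max0n maxn0 maxnn.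
Qed.

Lemma level_gt0 (x y : V) : x != y -> (0 < level x y)%N.
Proof.
move=> xy; have [i xyi] : exists i, x i != y i.
  apply/existsP; rewrite -negb_forall; apply: contraNN xy => /forallP xy.
  by apply/eqP/ffunP => i; apply/eqP.
exact: leq_trans (@leq_bigmax_cond _ _ (fun i : 'I_n => i.+1) _ xyi).
Qed.

Lemma J_edge_ge0 e : 0 <= J (edge_len e).
Proof. by have [x [y [xy _ ->]]] := edge_lenE e; exact/J_ge0/level_gt0. Qed.

Lemma open_prob_itv e : 0 <= open_prob J e <= 1.
Proof.
rewrite /open_prob subr_ge0 -expR0 ler_expR oppr_le0 J_edge_ge0 /=.
by rewrite lerBlDr lerDl expR_ge0.
Qed.

Lemma config_prob_ge0 w : 0 <= config_prob J w.
Proof.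
apply: prodr_ge0 => e _; have /andP[p0 p1] := open_prob_itv e.
by case: (w e) => //; rewrite subr_ge0.
Qed.

(** Expanding a product over edges of two-term sums gives one term per configuration. A constant [h]
    yields total mass 1, and a product of indicators yields the probability that a set of edges is
    closed. *)
Lemma Ex_prod (h : E -> bool -> R) :
  Ex (fun w => \prod_e h e (w e)) =
  \prod_e (open_prob J e * h e true + (1 - open_prob J e) * h e false).
Proof.
pose g e (b : bool) := (if b then open_prob J e else 1 - open_prob J e) * h e b.
transitivity (\prod_e \sum_(b : bool) g e b).
  rewrite bigA_distr_bigA; apply: eq_bigr => w _.
  by rewrite /config_prob -big_split.
by apply: eq_bigr => e _; rewrite big_bool.
Qed.

Lemma Ex_cst c : Ex (fun=> c) = c.
Proof.
have Ex1 : Ex (fun=> 1) = 1.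
  have := Ex_prod (fun _ _ => 1).
  under [X in _ = X -> _]eq_bigr do rewrite !mulr1 addrCA subrr addr0.
  by rewrite big1_eq => p1; rewrite -[RHS]p1; apply: eq_Ex.
rewrite -[RHS]mul1r -[in RHS]Ex1 /Ex mulr_suml.
by apply: eq_bigr => w _; rewrite mulr1.
Qed.

Lemma le_Ex f g : (forall w, f w <= g w) -> Ex f <= Ex g.
Proof.
by move=> fg; apply: ler_sum => w _; rewrite ler_wpM2l// config_prob_ge0.
Qed.

Lemma Ex_ge0 f : (forall w, 0 <= f w) -> 0 <= Ex f.
Proof. by move=> f0; rewrite -(Ex_cst 0) le_Ex. Qed.

Lemma ExD f g : Ex (fun w => f w + g w) = Ex f + Ex g.
Proof. by rewrite /Ex -big_split; apply: eq_bigr => w _; rewrite mulrDr. Qed.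

Lemma ExZ c f : Ex (fun w => c * f w) = c * Ex f.
Proof. by rewrite /Ex mulr_sumr; apply: eq_bigr => w _; rewrite mulrCA. Qed.

Lemma ExZr c f : Ex (fun w => f w * c) = Ex f * c.
Proof. by rewrite mulrC -ExZ; apply: eq_Ex => w; rewrite mulrC. Qed.

Lemma ExB f g : Ex (fun w => f w - g w) = Ex f - Ex g.
Proof. by rewrite -[X in _ + X]mulN1r -ExZ -ExD; apply: eq_Ex => w; rewrite mulN1r. Qed.

Lemma Ex_sum (I : Type) (s : seq I) (P : pred I) (f : I -> C -> R) :
  Ex (fun w => \sum_(i <- s | P i) f i w) = \sum_(i <- s | P i) Ex (f i).
Proof. by rewrite /Ex exchange_big; apply: eq_bigr => w _; rewrite mulr_sumr. Qed.

Lemma Ex_cov (f g : C -> R) a b : Ex f = a -> Ex g = b ->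
  Ex (fun w => (f w - a) * (g w - b)) = Ex (fun w => f w * g w) - a * b.
Proof.
move=> fa gb.
transitivity (Ex (fun w => f w * g w - f w * b - a * g w + a * b)).
  by apply: eq_Ex => w; ring.
by rewrite ExD !ExB ExZr ExZ fa gb Ex_cst; ring.
Qed.

Lemma Pr_ge0 P : 0 <= Pr P.
Proof. by apply: Ex_ge0 => w; rewrite ler0n. Qed.

Lemma le_Pr (P Q : pred C) : (forall w, P w -> Q w) -> Pr P <= Pr Q.
Proof. by move=> PQ; apply: le_Ex => w; rewrite ler_nat; case: (P w) (PQ w) => // ->. Qed.

Lemma eq_Pr (P Q : pred C) : P =1 Q -> Pr P = Pr Q.
Proof. by move=> PQ; apply: eq_Ex => w; rewrite PQ. Qed.

Lemma Pr_le1 P : Pr P <= 1.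
Proof. by rewrite -[leRHS](Ex_cst 1); apply: le_Ex => w; rewrite lern1 leq_b1. Qed.

Lemma PrC (P : pred C) : Pr (predC P) = 1 - Pr P.
Proof.
rewrite -[in RHS](Ex_cst 1) -ExB; apply: eq_Ex => w /=.
by case: (P w); rewrite ?subrr ?subr0.
Qed.

Lemma PrU (P Q : pred C) : Pr (fun w => P w || Q w) <= Pr P + Pr Q.
Proof.
rewrite -ExD; apply: le_Ex => w; rewrite -natrD ler_nat.
by case: (P w); case: (Q w).
Qed.

Lemma Pr_exists (I : finType) (A : pred I) (P : I -> pred C) :
  Pr (fun w => [exists i in A, P i w]) <= \sum_(i in A) Pr (P i).
Proof.
rewrite -Ex_sum; apply: le_Ex => w; rewrite -natr_sum ler_nat.
case: existsP => // -[i /andP[Ai Pi]].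
by rewrite (bigD1 i)//= Pi.
Qed.

Lemma PrE (P : pred C) : Pr P = \sum_(w | P w) config_prob J w.
Proof.
rewrite /Pr /Ex [RHS]big_mkcond; apply: eq_bigr => w _.
by case: (P w); rewrite ?mulr1 ?mulr0.
Qed.

Lemma markov_ineq (f : C -> R) c (P : pred C) : 0 < c ->
  (forall w, 0 <= f w) -> (forall w, P w -> c <= f w) -> Pr P <= Ex f / c.
Proof.
move=> c0 f0 Pf; rewrite ler_pdivlMr// -ExZr; apply: le_Ex => w.
by case: (boolP (P w)) => [/Pf|_]; rewrite ?mul1r ?mul0r.
Qed.

Definition mix (D : {set E}) (w w' : C) : C := [ffun e => if e \in D then w e else w' e].

Lemma config_prob_mix D w w' :
  config_prob J (mix D w w') * config_prob J (mix D w' w) =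
  config_prob J w * config_prob J w'.
Proof.
rewrite /config_prob -!big_split; apply: eq_bigr => e _ /=; rewrite !ffunE.
by case: (e \in D); rewrite // mulrC.
Qed.

(* Exchanging the coordinates outside [D] of two independent copies preserves
   their joint law. *)
Lemma Ex_indep D D' f g : depends_on D f -> depends_on D' g ->
  [disjoint D & D'] -> Ex (fun w => f w * g w) = Ex f * Ex g.
Proof.
move=> fD gD' dis.
transitivity (Ex (fun w => Ex (fun w' => f w * g w))).
  by apply: eq_Ex => w; rewrite Ex_cst.
rewrite /Ex mulr_suml.
under eq_bigr do rewrite mulr_sumr.
under [RHS]eq_bigr do rewrite mulr_sumr.
rewrite !pair_big /=.
pose sw (u : C * C) := (mix D u.1 u.2, mix D u.2 u.1).
have swK : involutive sw.
  by move=> [u v]; congr pair; apply/ffunP => e; rewrite !ffunE/=; case: (e \in D).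
rewrite (reindex_inj (inv_inj swK)) /=; apply: eq_bigr => -[u v] _ /=.
rewrite mulrA config_prob_mix.
have -> : f (mix D u v) = f u by apply: fD => e eD; rewrite ffunE eD.
have -> : g (mix D u v) = g v.
  apply: gD' => e eD'; rewrite ffunE ifF//.
  by apply/negbTE/negP => eD; have /disjointFr := dis => /(_ _ eD); rewrite eD'.
ring.
Qed.

Lemma Pr_closed_in F : Pr (closed_in F) = expR (- \sum_(e in F) J (edge_len e)).
Proof.
transitivity (Ex (fun w => \prod_e (if (e \in F) && w e then 0 else 1))).
  apply: eq_Ex => w; case: (boolP (closed_in F w)) => [/forall_inP cl|].
    by rewrite big1// => e _; case: ifP => // /andP[/cl/negbTE->].
  rewrite negb_forall_in => /exists_inP[e eF /negbNE we].
  by rewrite (bigD1 e)//= eF we mul0r.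
rewrite (Ex_prod (fun e b => if (e \in F) && b then 0 else 1)).
rewrite -sumrN expR_sum [RHS]big_mkcond; apply: eq_bigr => e _ /=.
rewrite andbF andbT mulr1; case: ifP => _; last by rewrite mulr1 addrCA subrr addr0.
by rewrite mulr0 add0r /open_prob subKr.
Qed.

Lemma depends_on_closed_in F : depends_on F (closed_in F).
Proof.
move=> w w' ww'; apply: eq_forallb => e; case: (boolP (e \in F)) => //= eF.
by rewrite ww'.
Qed.

(** Conditioning on the edges of [D] fixes both [f] and [X], while the edges of [X] are still fresh
    because [X] avoids [D]. In the finite setting this means splitting on the value [F] of [X] and
    using independence for each [F]. *)
Lemma Ex_random_closed D (f : C -> R) (X : C -> {set E}) :
  depends_on D f -> depends_on D X -> (forall w, [disjoint X w & D]) ->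
  Ex (fun w => f w * (closed_in (X w) w)%:R) =
  Ex (fun w => f w * expR (- \sum_(e in X w) J (edge_len e))).
Proof.
move=> fD XD XdD.
have spl (h : {set E} -> C -> R) :
    Ex (fun w => f w * h (X w) w) =
    \sum_(F : {set E}) Ex (fun w => (f w * (X w == F)%:R) * h F w).
  rewrite -Ex_sum; apply: eq_Ex => w.
  rewrite (bigD1 (X w))//= eqxx mulr1 big1 ?addr0// => F.
  by rewrite eq_sym => /negbTE->; rewrite mulr0 mul0r.
rewrite (spl (fun F w => (closed_in F w)%:R)).
rewrite (spl (fun F w => expR (- \sum_(e in F) J (edge_len e)))).
apply: eq_bigr => F _; rewrite ExZr.
have [FD|nFD] := boolP [disjoint F & D]; last first.
  have z w : f w * (X w == F)%:R = 0.
    by case: eqP => [XF|_]; rewrite ?mulr0//; move: nFD; rewrite -XF XdD.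
  under eq_Ex do rewrite z mul0r.
  by under [X in _ = X * _]eq_Ex do rewrite z; rewrite !Ex_cst mul0r.
rewrite -Pr_closed_in; apply: (@Ex_indep D F).
- by move=> w w' ww'; rewrite (fD _ _ ww') (XD _ _ ww').
- by move=> w w' ww'; rewrite (depends_on_closed_in ww').
- by rewrite disjoint_sym.
Qed.

End Expectation.

(** * The ultrametric and its isoperimetry *)

Section Ultrametric.
Variables (d L n : nat).
Notation V := (vert d L n).
Implicit Types (x y z : V) (j : nat).

Lemma level_leqP j x y :
  reflect (forall i : 'I_n, (j <= i)%N -> x i = y i) (level x y <= j)%N.
Proof.
apply: (iffP (bigmax_leqP _ _ _)) => [xy i ji|xy i].
  by apply/eqP; apply: contraTT ji => /xy; rewrite ltnNge.
by apply: contraNT; rewrite -ltnNge ltnS => /xy ->.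
Qed.

Lemma levelxx x : level x x = 0%N.
Proof. by apply/eqP; rewrite -leqn0; apply/level_leqP. Qed.

Lemma level_sym x y : level x y = level y x.
Proof. by apply: eq_bigl => i; rewrite eq_sym. Qed.

Lemma level_eq0 x y : (level x y == 0%N) = (x == y).
Proof.
apply/idP/eqP => [|->]; last by rewrite levelxx.
by rewrite -leqn0 => /level_leqP xy; apply/ffunP => i; exact: xy.
Qed.

Lemma level_le_n x y : (level x y <= n)%N.
Proof. by apply/level_leqP => i; rewrite leqNgt ltn_ord. Qed.

Lemma level_trans j x y z :
  (level x y <= j)%N -> (level y z <= j)%N -> (level x z <= j)%N.
Proof.
move=> /level_leqP xy /level_leqP yz; apply/level_leqP => i ji.
by rewrite xy ?yz.
Qed.

Definition hball j x : {set V} := [set y | (level x y <= j)%N].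

Lemma in_hball j x y : (y \in hball j x) = (level x y <= j)%N.
Proof. by rewrite inE. Qed.

Lemma hball_refl j x : x \in hball j x.
Proof. by rewrite in_hball levelxx. Qed.

Lemma hball_sym j x y : (x \in hball j y) = (y \in hball j x).
Proof. by rewrite !in_hball level_sym. Qed.

Lemma hball_eq j x y : y \in hball j x -> hball j y = hball j x.
Proof.
rewrite in_hball => xy; apply/setP => z; rewrite !in_hball; apply/idP/idP.
  exact: level_trans.
by apply: level_trans; rewrite level_sym.
Qed.

Lemma hball_subset j j' x : (j <= j')%N -> hball j x \subset hball j' x.
Proof. by move=> jj'; apply/subsetP => y; rewrite !in_hball => /leq_trans->. Qed.

Lemma hball_sub j j' x y : (j <= j')%N -> y \in hball j' x -> hball j y \subset hball j' x.
Proof. by move=> jj' /hball_eq <-; exact: hball_subset. Qed.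

Lemma hball_full j x : (n <= j)%N -> hball j x = [set: V].
Proof. by move=> nj; apply/setP => y; rewrite in_hball inE (leq_trans (level_le_n _ _)). Qed.

Lemma hball0 x : hball 0 x = [set x].
Proof. by apply/setP => y; rewrite in_hball inE leqn0 level_eq0 eq_sym. Qed.

Lemma hball_disjoint j x y : y \notin hball j x -> [disjoint hball j x & hball j y].
Proof.
move=> yx; rewrite -setI_eq0; apply/eqP/setP => z; rewrite !inE.
apply: contraNF yx => /andP[xz yz]; rewrite in_hball.
by apply: level_trans xz _; rewrite level_sym.
Qed.

Lemma level_isosceles j x y z : y \notin hball j x -> z \in hball j y ->
  level x z = level x y.
Proof.
rewrite !in_hball -ltnNge => jxy jyz; apply/eqP; rewrite eqn_leq; apply/andP; split.
  by apply: level_trans (leqnn _) _; rewrite (leq_trans jyz)// ltnW.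
have yz : (level z y <= j)%N by rewrite level_sym.
rewrite leqNgt; apply/negP => h.
have jxz : (level x z <= (level x y).-1)%N by rewrite -ltnS prednK//; lia.
by have := level_trans jxz (leq_trans yz _) => /(_ _)/implyP; lia.
Qed.

(** The coordinates of index below [j] are free and the others are those of [x], so the ball is a
    product in which [j] factors have size [L ^ d] and the others are singletons. *)
Lemma card_hball j x : (j <= n)%N -> #|hball j x| = ((L ^ d) ^ j)%N.
Proof.
move=> jn.
pose F (i : 'I_n) := if (i < j)%N then predT else pred1 (x i).
have -> : #|hball j x| = #|family F|.
  apply: eq_card => y; rewrite in_hball; apply/level_leqP/familyP => h i.
    by rewrite /F; case: ltnP => // /h ->; rewrite inE.
  by move=> ji; have := h i; rewrite /F ltnNge ji/= => /eqP.
rewrite card_family -[RHS]muln1 foldrE big_map big_enum /=.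
rewrite (eq_bigr (fun i : 'I_n => if (i < j)%N then L ^ d else 1)%N); last first.
  move=> i _; rewrite /F; case: ifP => _; last by rewrite card1.
  by rewrite card_ffun !card_ord.
by rewrite -big_mkcond /= (big_ord_narrow jn) big_const_ord iter_muln.
Qed.

Lemma hball_lvl j x y z : y \in hball j x -> z \notin hball j x -> level y z = level x z.
Proof.
move=> yx zx; rewrite level_sym [RHS]level_sym; apply: level_isosceles yx.
by rewrite hball_sym.
Qed.

End Ultrametric.

(** * Sums over balls and the isoperimetric inequality *)

Section BallSums.
Variables (R : realType) (d L n : nat).
Hypothesis L2 : (2 <= L)%N.
Hypothesis d1 : (1 <= d)%N.
Notation V := (vert d L n).
Notation N := ((L ^ d)%N%:R : R).
Implicit Types (x y z : V) (j : nat) (S A : {set V}).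

Lemma N_ge2 : 2 <= N.
Proof.
rewrite ler_nat (leq_trans L2)// -{1}(expn1 L) leq_exp2l//.
Qed.

Let N_gt0 : 0 < N. Proof. by rewrite (lt_le_trans _ N_ge2). Qed.
Let N_neq0 : N != 0. Proof. by rewrite gt_eqF. Qed.

Lemma sum1_cardR (T : finType) (A : {set T}) : \sum_(i in A) 1 = #|A|%:R :> R.
Proof. by rewrite sumr_const. Qed.

Lemma card_hballR j x : (j <= n)%N -> #|hball j x|%:R = N ^+ j :> R.
Proof. by move=> jn; rewrite card_hball// natrX. Qed.

(** After exchanging the two sums, each [c z] is counted once for every point of [S] in the ball of
    [z], with weight the inverse of their number. *)
Lemma hball_avg_in j S (c : V -> R) :
  \sum_(y in S) c y =
  \sum_(y in S) (\sum_(z in S :&: hball j y) c z) / #|S :&: hball j y|%:R.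
Proof.
under [RHS]eq_bigr do rewrite mulr_suml.
rewrite (exchange_big_dep (fun z => z \in S))/=; last by move=> y z _; rewrite inE => /andP[].
apply: eq_bigr => z zS.
rewrite (eq_bigl (fun y => y \in S :&: hball j z)); last first.
  by move=> y; rewrite !inE zS/= level_sym.
rewrite (eq_bigr (fun=> c z / #|S :&: hball j z|%:R)); last first.
  by move=> y; rewrite inE => /andP[_ /hball_eq ->].
rewrite sumr_const -[RHS]mulr_natr divfK// pnatr_eq0 -lt0n.
by apply/card_gt0P; exists z; rewrite inE zS hball_refl.
Qed.

Definition saturated j A := forall y, y \in A -> hball j y \subset A.

Lemma hball_saturated j j' x : (j <= j')%N -> saturated j (hball j' x).
Proof. by move=> jj' y; exact: hball_sub. Qed.

Lemma hball_avg j A (g f : V -> R) : (j <= n)%N -> saturated j A ->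
  (forall y z, y \in A -> z \in hball j y -> g z = g y) ->
  \sum_(y in A) g y * f y = \sum_(y in A) g y * ((\sum_(z in hball j y) f z) / N ^+ j).
Proof.
move=> jn satA gj; rewrite (hball_avg_in j); apply: eq_bigr => y yA.
have -> : A :&: hball j y = hball j y by apply/setIidPr/satA.
rewrite card_hballR// mulrA mulr_sumr; congr (_ / _).
by apply: eq_bigr => z zy; rewrite (gj y z).
Qed.

Lemma sum_shells m j x (f : nat -> R) : (m <= j <= n)%N ->
  \sum_(y in hball j x :\: hball m x) f (level x y) =
  \sum_(m <= l < j) (N ^+ l.+1 - N ^+ l) * f l.+1.
Proof.
move=> /andP[mj]; elim: j mj => [|j IH]; first by rewrite leqn0 => /eqP -> _; rewrite setDv big_set0 big_geq.
rewrite leq_eqVlt => /orP[/eqP -> _|]; first by rewrite setDv big_set0 big_geq.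
rewrite ltnS => mj jn; rewrite big_nat_recr//= -IH ?(ltnW jn)//.
rewrite (big_setID (hball j x)); congr (_ + _).
  by apply: eq_bigl => y; rewrite !inE andbAC -andbA andbCA; case: (boolP (_ <= j)%N) => [/leqW->|]; rewrite ?andbF ?andbT.
rewrite (eq_bigl (fun y => y \in hball j.+1 x :\: hball j x)); last first.
  move=> y; rewrite !inE -!ltnNge; case: (leqP (level x y) j) => //= jl.
  by rewrite (leq_ltn_trans mj jl).
rewrite (eq_bigr (fun=> f j.+1)); last first.
  by move=> y; rewrite !inE -ltnNge => /andP[l1 l2]; congr f; lia.
rewrite sumr_const -[LHS]mulr_natr mulrC; congr (_ * _).
have sub := hball_subset x (leqnSn j).
by rewrite cardsD (setIidPr sub) natrB ?subset_leq_card// !card_hballR// ltnW.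
Qed.

(** The kernel without its logarithmic factor. It is normalised so that the cut between a ball of
    level [j] and the rest of a ball of level [j'] weighs [1 - N ^ j / N ^ j']. *)
Definition cutw y z : R := N / N ^+ (2 * level y z).

Lemma cutw_ge0 y z : 0 <= cutw y z.
Proof. by rewrite divr_ge0// ?exprn_ge0 ltW. Qed.

Lemma cutw_sym y z : cutw y z = cutw z y.
Proof. by rewrite /cutw level_sym. Qed.

(* With [s y] the number of points of [S] in the child ball of [y] and
   [K = \sum_(y in S) 1 / s y] the number of children met by [S], the induction
   hypothesis gives the lower bound [K - K (K - 1) / N >= 1]. *)
Lemma isoperimetry j x S : (j <= n)%N -> S \subset hball j x -> S != set0 ->
  1 <= \sum_(y in S) \sum_(z in hball j x :\: S) cutw y z + #|S|%:R / N ^+ j.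
Proof.
elim: j x S => [|j IH] x S jn SB S0.
  have Sx : S = [set x].
    move: SB; rewrite hball0 subset1 => /orP[/eqP//|]. by rewrite (negbTE S0).
  rewrite Sx cards1 expr0 divr1 lerDr; apply: sumr_ge0 => y _.
  by apply: sumr_ge0 => z _; exact: cutw_ge0.
have jn' := ltnW jn.
set B := hball j.+1 x in SB *.
pose s y := #|S :&: hball j y|%:R : R.
have s_gt0 y : y \in S -> 0 < s y.
  by move=> yS; rewrite ltr0n; apply/card_gt0P; exists y; rewrite inE yS hball_refl.
have s_le y : s y <= N ^+ j by rewrite -(card_hballR y jn') ler_nat subset_leq_card// subsetIr.
have Nj : 0 < N ^+ j by rewrite exprn_gt0.
pose c y := \sum_(z in hball j y :\: S) cutw y z.
pose K := \sum_(y in S) (s y)^-1.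
have K1 y : y \in S -> K - 1 = \sum_(z in S :\: hball j y) (s z)^-1.
  move=> yS; rewrite /K (big_setID (hball j y))/=.
  rewrite (eq_bigr (fun=> (s y)^-1)); last first.
    by move=> z; rewrite inE => /andP[_ zy]; rewrite /s (hball_eq zy).
  by rewrite sumr_const -[_ *+ _]mulr_natr mulVf ?gt_eqF ?s_gt0// addrAC subrr add0r.
have K_ge1 : 1 <= K.
  have /set0Pn[y yS] := S0; rewrite -subr_ge0 (K1 y yS); apply: sumr_ge0 => z.
  by rewrite inE => /andP[_ /s_gt0 /ltW]; rewrite invr_ge0.
have K_out y : y \in S -> #|S|%:R - s y <= (K - 1) * N ^+ j.
  move=> yS; rewrite (K1 y yS) mulr_suml.
  have -> : #|S|%:R - s y = \sum_(z in S :\: hball j y) 1.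
    by rewrite sumr_const cardsD natrB// subset_leq_card// subsetIl.
  apply: ler_sum => z; rewrite inE => /andP[_ zS].
  by rewrite mulrC ler_pdivlMr ?s_gt0// mul1r.
have K_S : #|S|%:R <= K * N ^+ j.
  rewrite -sum1_cardR mulr_suml; apply: ler_sum => z zS.
  by rewrite mulrC ler_pdivlMr ?s_gt0// mul1r.
have K_N : K <= N.
  (* The unit weight of each child met by [S] is spread evenly over the whole child, to be compared
     with the volume of the ball. *)
  have -> : K = \sum_(y in S) \sum_(z in hball j y) (s z)^-1 / N ^+ j.
    apply: eq_bigr => y yS; rewrite (eq_bigr (fun=> (s y)^-1 / N ^+ j)).
      by rewrite sumr_const -[RHS]mulr_natr card_hballR// divfK// gt_eqF.
    by move=> z zy; rewrite /s (hball_eq zy).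
  rewrite (exchange_big_dep (fun z => z \in B))/=; last first.
    move=> y z yS; apply/subsetP; apply: (@hball_saturated j j.+1 x) => //.
    exact: (subsetP SB).
  apply: (@le_trans _ _ (\sum_(z in B) (N ^+ j)^-1)).
    apply: ler_sum => z zB; rewrite (eq_bigl (fun y => y \in S :&: hball j z)); last first.
      by move=> y; rewrite !inE level_sym.
    rewrite sumr_const -[leLHS]mulr_natl mulrA ler_piMl ?invr_ge0 ?(ltW Nj)//.
    rewrite -/(s z); have [->|sz] := eqVneq (s z) 0; first by rewrite mul0r.
    by rewrite divff.
  by rewrite sumr_const -[leLHS]mulr_natr card_hballR// exprS mulrC mulfK ?gt_eqF.
(* The induction hypothesis, applied in each child to the part of [S] it contains, bounds the cut
   inside that child. Averaging over the points of [S] in the child turns the sum over children into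
   a sum over [S]. *)
have cS : K - #|S|%:R / N ^+ j <= \sum_(y in S) c y.
  rewrite [leRHS](hball_avg_in j) /K -sum1_cardR mulr_suml -sumrB; apply: ler_sum => y yS.
  rewrite -/(s y) ler_pdivlMr ?s_gt0// mulrBl mulVf ?gt_eqF ?s_gt0// mul1r.
  rewrite lerBlDr [X in _ + X]mulrC.
  have := IH y (S :&: hball j y) jn' (subsetIr _ _).
  have -> : S :&: hball j y != set0.
    by apply/set0Pn; exists y; rewrite inE yS hball_refl.
  move=> /(_ isT) /le_trans; apply; rewrite lerD2r; apply: ler_sum => z.
  rewrite inE => /andP[zS zy]; rewrite /c (hball_eq zy).
  rewrite le_eqVlt; apply/orP; left; apply/eqP; apply: eq_bigl => u.
  by rewrite !inE; case: (level y u <= j)%N; rewrite ?andbF ?andbT.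
(* Outside its own child, a point of [S] sees all other points of [B] at level exactly [j.+1], so
   this part of the cut is a count. *)
have out y : y \in S -> \sum_(z in B :\: S) cutw y z =
    c y + (N ^+ j.+1 - N ^+ j - (#|S|%:R - s y)) * (N / N ^+ (2 * j.+1)).
  move=> yS; have yB : y \in B := subsetP SB _ yS.
  have ByB : hball j y \subset B by exact: (@hball_saturated j j.+1 x).
  rewrite (big_setID (hball j y)); congr (_ + _).
    apply: eq_bigl => z; rewrite !inE; case: (boolP (level y z <= j)%N) => //= zy.
      by have := subsetP ByB z; rewrite !in_hball zy => /(_ isT) ->; rewrite ?andbT.
    by rewrite ?andbF.
  rewrite (eq_bigr (fun=> N / N ^+ (2 * j.+1))); last first.
    move=> z; rewrite !inE -ltnNge => /andP[yz /andP[_ zB]].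
    have zB' : z \in hball j.+1 y by rewrite (hball_eq yB) in_hball.
    by rewrite in_hball in zB'; rewrite /cutw (@anti_leq (level y z) j.+1) ?zB'.
  rewrite sumr_const -[LHS]mulr_natl; congr (_ * _).
  have -> : (B :\: S) :\: hball j y = (B :\: hball j y) :\: (S :\: hball j y).
    by apply/setP => z; rewrite !inE; do 3![case: (_ \in _) => //=|case: (_ <= _)%N => //=].
  have sub2 : S :\: hball j y \subset B :\: hball j y by apply: setSD.
  rewrite cardsD (setIidPr sub2) natrB ?subset_leq_card//.
  rewrite cardsD (setIidPr ByB) natrB ?subset_leq_card//.
  rewrite cardsD natrB ?subset_leq_card// ?subsetIl// !card_hballR//.
rewrite (eq_bigr _ out) big_split/= -mulr_suml.
rewrite sumrB sumr_const -[_ *+ _]mulr_natr.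
have sumout : \sum_(y in S) (#|S|%:R - s y) <= K * N ^+ j * ((K - 1) * N ^+ j).
  apply: (@le_trans _ _ (\sum_(y in S) ((K - 1) * N ^+ j))).
    by apply: ler_sum => y; exact: K_out.
  rewrite sumr_const -[_ *+ _]mulr_natr mulrC ler_wpM2r// mulr_ge0 ?subr_ge0// ltW//.
have NE : N / N ^+ (2 * j.+1) = (N * N ^+ j * N ^+ j)^-1.
  rewrite mulnC exprM expr2 exprS; field; by rewrite N_neq0 gt_eqF.
rewrite NE exprS.
set sS := \sum_(y in S) c y in cS *; set T := \sum_(y in S) _ in sumout *.
set P := N ^+ j in Nj cS sumout K_S *; set k := #|S|%:R in cS K_S *.
have -> : sS + ((N * P - P) * k - T) / (N * P * P) + k / (N * P) =
  sS + k / P - T / (N * P * P).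
  by field; rewrite N_neq0 gt_eqF.
have TK : T / (N * P * P) <= K * (K - 1) / N.
  rewrite ler_pdivrMr ?mulr_gt0//.
  have -> : K * (K - 1) / N * (N * P * P) = K * P * ((K - 1) * P).
    by field.
  by [].
have KN : K * (K - 1) / N <= K - 1.
  by rewrite ler_pdivrMr// mulrC ler_wpM2l// subr_ge0.
lra.
Qed.

End BallSums.

(** * Edges between vertex sets, and the exploration of random cuts *)

Section Crossing.
Variables (R : realType) (d L n : nat) (J : nat -> R).
Hypothesis J_ge0 : forall k, (1 <= k)%N -> 0 <= J (L ^ k)%N.
Notation V := (vert d L n).
Notation E := (edge d L n).
Notation C := (config d L n).
Implicit Types (x y z : V) (e : E) (w : C) (X Y A : {set V}).

Definition rate x y : R := J (L ^ level x y)%N.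

Lemma rate_ge0 x y : x != y -> 0 <= rate x y.
Proof. by move=> xy; apply/J_ge0/level_gt0. Qed.

Definition cross X Y : {set E} :=
  [set e : E | [exists x in X, [exists y in Y, val e == [set x; y]]]].

Lemma crossP X Y e :
  reflect (exists x y, [/\ x \in X, y \in Y & val e = [set x; y]]) (e \in cross X Y).
Proof.
rewrite inE; apply: (iffP exists_inP) => [[x xX /exists_inP[y yY /eqP eE]]|[x [y [xX yY eE]]]].
  by exists x, y.
by exists x => //; apply/exists_inP; exists y => //; apply/eqP.
Qed.

Lemma mk_edge x y : x != y -> exists e : E, val e = [set x; y].
Proof.
move=> xy; have c : #|[set x; y]| == 2%N by rewrite cards2 xy.
by exists (Sub [set x; y] c).
Qed.

Lemma edge_len_pair e x y : val e = [set x; y] -> edge_len e = (L ^ level x y)%N.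
Proof.
have [x' [y' [xy' eE ->]]] := edge_lenE e; rewrite eE => h.
have x'x : x' \in [set x; y] by rewrite -h !inE eqxx.
have y'y : y' \in [set x; y] by rewrite -h !inE eqxx orbT.
move: x'x y'y xy'; rewrite !inE => /orP[]/eqP-> /orP[]/eqP->; rewrite ?eqxx// => _.
by rewrite level_sym.
Qed.

Lemma set2_disjoint_inj X Y x y x' y' : [disjoint X & Y] ->
  x \in X -> y \in Y -> x' \in X -> y' \in Y -> [set x; y] = [set x'; y'] ->
  x = x' /\ y = y'.
Proof.
move=> dis xX yY x'X y'Y h.
have x'x : x \in [set x'; y'] by rewrite -h !inE eqxx.
have y'y : y \in [set x'; y'] by rewrite -h !inE eqxx orbT.
move: x'x y'y; rewrite !inE => /orP[]/eqP xE /orP[]/eqP yE; split=> //; subst.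
- by move: yY; rewrite (disjointFr dis).
- by move: xX; rewrite (disjointFl dis).
- by move: xX; rewrite (disjointFl dis).
- by move: xX; rewrite (disjointFl dis).
Qed.

Lemma sum_cross X Y : [disjoint X & Y] ->
  \sum_(e in cross X Y) J (edge_len e) = \sum_(x in X) \sum_(y in Y) rate x y.
Proof.
move=> dis.
transitivity (\sum_(x in X) \sum_(y in Y) \sum_(e : E | val e == [set x; y]) J (edge_len e)).
  rewrite pair_big_dep/= (exchange_big_dep (fun e => e \in cross X Y))/=; last first.
    by move=> [x y] e /= /andP[xX yY] /eqP eE; apply/crossP; exists x, y.
  apply: eq_bigr => e /crossP[x [y [xX yY eE]]].
  rewrite (bigD1 (x, y)) /= ?xX ?yY ?eE ?eqxx// big1 ?addr0//.
  move=> [x' y'] /= /andP[/andP[/andP[x'X y'Y] /eqP eE']].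
  by have [-> ->] := set2_disjoint_inj dis xX yY x'X y'Y eE'; rewrite eqxx.
apply: eq_bigr => x xX; apply: eq_bigr => y yY.
have xy : x != y by apply: contraTneq xX => ->; rewrite (disjointFl dis).
have [e eE] := mk_edge xy.
rewrite (big_pred1 e) ?(edge_len_pair eE)// => e'.
by rewrite -eE (inj_eq val_inj).
Qed.

Lemma open_adjP w x y :
  reflect (exists e, [/\ x \in val e, y \in val e & w e]) (open_adj w x y).
Proof.
apply: (iffP existsP) => -[e]; first by move=> /and3P[]; exists e.
by move=> [xe ye we]; exists e; rewrite xe ye.
Qed.

Lemma open_adjE w x y e : x != y -> val e = [set x; y] -> open_adj w x y = w e.
Proof.
move=> xy eE; apply/open_adjP/idP => [[e' [xe ye we]]|we]; last first.
  by exists e; rewrite eE !inE !eqxx orbT.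
suff -> : e = e' by [].
apply: val_inj; rewrite eE; apply/eqP; rewrite eqEcard subUset !sub1set xe ye/=.
by rewrite cards2 xy (eqP (valP e')).
Qed.

Lemma closed_crossP w X Y : [disjoint X & Y] ->
  reflect (forall x y, x \in X -> y \in Y -> ~~ open_adj w x y)
          (closed_in (cross X Y) w).
Proof.
move=> dis; apply: (iffP forall_inP) => [cl x y xX yY|cl e /crossP[x [y [xX yY eE]]]].
  have xy : x != y by apply: contraTneq xX => ->; rewrite (disjointFl dis).
  have [e eE] := mk_edge xy; rewrite (open_adjE _ xy eE); apply: cl.
  by apply/crossP; exists x, y.
have xy : x != y by apply: contraTneq xX => ->; rewrite (disjointFl dis).
by rewrite -(open_adjE _ xy eE) cl.
Qed.

Lemma open_adj_sym w : symmetric (open_adj w).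
Proof. by move=> x y; apply/open_adjP/open_adjP => -[e [xe ye we]]; exists e. Qed.

Definition inside A : {set E} := [set e : E | val e \subset A].
(** These are the edges of level at most [j]. Cores of scale [k] will be determined by the edges of
    level at most [r * k], so that all longer edges remain unexplored. *)
Definition low j : {set E} := [set e : E | [exists x, val e \subset hball j x]].

Lemma in_inside A x y e : val e = [set x; y] ->
  (e \in inside A) = (x \in A) && (y \in A).
Proof. by move=> eE; rewrite inE eE subUset !sub1set. Qed.

Lemma in_low j x y e : val e = [set x; y] -> (e \in low j) = (y \in hball j x).
Proof.
move=> eE; rewrite inE; apply/existsP/idP => [[z]|yx]; last first.
  by exists x; rewrite eE subUset !sub1set hball_refl.
by rewrite eE subUset !sub1set => /andP[/hball_eq <-].
Qed.

Lemma inside_low j x : inside (hball j x) \subset low j.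
Proof. by apply/subsetP => e; rewrite !inE => ?; apply/existsP; exists x. Qed.

Lemma cross_disjoint_inside X Y A : [disjoint Y & A] -> [disjoint cross X Y & inside A].
Proof.
move=> YA; rewrite disjoint_subset; apply/subsetP => e /crossP[x [y [xX yY eE]]].
by rewrite inE/= (in_inside _ eE) (disjointFr YA yY) andbF.
Qed.

Lemma cross_disjoint_low X Y j :
  (forall x y, x \in X -> y \in Y -> y \notin hball j x) -> [disjoint cross X Y & low j].
Proof.
move=> XY; rewrite disjoint_subset; apply/subsetP => e /crossP[x [y [xX yY eE]]].
by rewrite inE/= (in_low _ eE) XY.
Qed.

Lemma inside_disjoint A A' : [disjoint A & A'] -> [disjoint inside A & inside A'].
Proof.
move=> AA'; rewrite disjoint_subset; apply/subsetP => e.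
have [x [y [xy eE _]]] := edge_lenE e.
by rewrite (in_inside _ eE) inE/= (in_inside _ eE) => /andP[xA _]; rewrite (disjointFr AA' xA).
Qed.

Lemma insideS A A' : A \subset A' -> inside A \subset inside A'.
Proof. by move=> AA'; apply/subsetP => e; rewrite !inE => /subset_trans->. Qed.

Lemma depends_onS (T : Type) (D D' : {set E}) (f : C -> T) :
  D \subset D' -> depends_on D f -> depends_on D' f.
Proof. by move=> DD' fD w w' ww'; apply: fD => e /(subsetP DD'); exact: ww'. Qed.

Section NoCross.
Variables (D : {set E}) (X Y : C -> {set V}) (P : pred C).
Hypothesis PD : depends_on D P.
Hypothesis XD : depends_on D X.
Hypothesis YD : depends_on D Y.
Hypothesis dis : forall w, [disjoint X w & Y w].
Hypothesis disD : forall w, [disjoint cross (X w) (Y w) & D].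
Let no_cross w := closed_in (cross (X w) (Y w)) w.
Let total w := \sum_(x in X w) \sum_(y in Y w) rate x y.

(** [D] is the explored region: it determines [P] and the two random sets, while the edges between
    these sets are unexplored. Given [D], they are therefore all closed with probability
    [expR (- total w)]. A bound on [total] over the event [P] then gives the two inequalities that
    follow. *)
Lemma Pr_no_crossE :
  Pr J (fun w => P w && no_cross w) = Ex J (fun w => (P w)%:R * expR (- total w)).
Proof.
rewrite /Pr; under eq_Ex do rewrite -mulnb natrM.
rewrite (@Ex_random_closed _ _ _ _ J D (fun w => (P w)%:R) (fun w => cross (X w) (Y w)))//.
- by apply: eq_Ex => w; rewrite sum_cross.
- by move=> w w' ww'; rewrite (PD ww').
- by move=> w w' ww'; rewrite (XD ww') (YD ww').
Qed.

Lemma Pr_no_cross_le s : (forall w, P w -> s <= total w) ->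
  Pr J (fun w => P w && no_cross w) <= Pr J P * expR (- s).
Proof.
move=> Ps; rewrite Pr_no_crossE -ExZr; apply: le_Ex => // w.
case: (boolP (P w)) => [/Ps sw|_]; last by rewrite !mul0r.
by rewrite !mul1r ler_expR lerN2.
Qed.

Lemma Pr_no_cross_ge s : (forall w, P w -> total w <= s) ->
  Pr J P * expR (- s) <= Pr J (fun w => P w && no_cross w).
Proof.
move=> Ps; rewrite Pr_no_crossE -ExZr; apply: le_Ex => // w.
case: (boolP (P w)) => [/Ps sw|_]; last by rewrite !mul0r.
by rewrite !mul1r ler_expR lerN2.
Qed.

End NoCross.

(** From [1 - expR (- s) <= s], with [s] the total rate of the edges in question. *)
Lemma Pr_some_cross X Y : [disjoint X & Y] ->
  Pr J (fun w => ~~ closed_in (cross X Y) w) <= \sum_(x in X) \sum_(y in Y) rate x y.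
Proof.
move=> dis; rewrite PrC Pr_closed_in// sum_cross//.
by rewrite lerBlDr -lerBlDl -[X in 1 + X]opprK; have := expR_ge1Dx (- \sum_(x in X) \sum_(y in Y) rate x y); lra.
Qed.

End Crossing.

(** * Absence of percolation for [a <= 1] *)

Section Subcritical.
Variables (R : realType) (d L n : nat) (J : nat -> R).
Hypothesis L2 : (2 <= L)%N.
Hypothesis d1 : (1 <= d)%N.
Hypothesis J_ge0 : forall k, (1 <= k)%N -> 0 <= J (L ^ k)%N.
Notation V := (vert d L n).
Notation E := (edge d L n).
Notation C := (config d L n).
Notation N := ((L ^ d)%N%:R : R).
Notation Prob := (@Pr R d L n J).
Notation rt := (@rate R d L n J).
Implicit Types (x y z : V) (e : E) (w : C).

Lemma L_gt0 : (0 < L)%N. Proof. exact: ltnW. Qed.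

Definition origin : V := [ffun _ => [ffun _ => Ordinal L_gt0]].

Lemma is_originE x : is_origin x = (x == origin).
Proof.
apply/forallP/eqP => [x0|-> i]; last by apply/forallP => k; rewrite !ffunE.
apply/ffunP => i; apply/ffunP => k; rewrite !ffunE.
by apply/val_inj => /=; apply/eqP; have /forallP := x0 i.
Qed.

Lemma in_cluster w y : (y \in Defs.cluster w) = connect (open_adj w) origin y.
Proof.
rewrite inE; apply/existsP/idP => [[x]|oy]; first by rewrite is_originE => /andP[/eqP ->].
by exists origin; rewrite is_originE eqxx.
Qed.

Lemma connect_closed (T : finType) (e : rel T) (S : {set T}) (x y : T) :
  (forall u v, u \in S -> e u v -> v \in S) -> x \in S -> connect e x y -> y \in S.
Proof.
move=> Se xS /connectP[p]; elim: p x xS => [|z p IH] x xS /=; first by move=> _ ->.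
by move=> /andP[/(Se _ _ xS)]; exact: IH.
Qed.

(** The total rate of the edges from a given vertex to the vertices at level exactly [l.+1]. *)
Definition shell l : R := (N ^+ l.+1 - N ^+ l) * J (L ^ l.+1)%N.

Lemma shell_ge0 l : 0 <= shell l.
Proof.
rewrite mulr_ge0 ?J_ge0// subr_ge0 ler_weXn2l//.
by rewrite (le_trans _ (N_ge2 R L2 d1))// ler1n.
Qed.

Lemma sum_rate_shell m j x : (m <= j <= n)%N ->
  \sum_(y in hball j x :\: hball m x) rt x y = \sum_(m <= l < j) shell l.
Proof. exact: (sum_shells L2 d1 x (fun l => J (L ^ l)%N)). Qed.

Definition isol_edges j x : {set E} := cross [set x] (hball j x :\ x).
Definition isolated j x w := closed_in (isol_edges j x) w.
(** Being active is decided by the edges inside the ball, which keeps the outgoing edges independent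
    of the active set. *)
Definition active j w : {set V} := [set x in hball j origin | ~~ isolated j x w].

Let dis1 j x : [disjoint [set x] & hball j x :\ x].
Proof. by rewrite disjoints1 !inE eqxx. Qed.

Lemma Pr_isolated j x : (j <= n)%N -> Prob (isolated j x) = expR (- \sum_(0 <= l < j) shell l).
Proof.
move=> jn; rewrite Pr_closed_in// sum_cross// big_set1 -(sum_rate_shell (m := 0) (j := j) x)//.
by rewrite hball0.
Qed.

(* The edge [xy] is the only one shared by the two isolation events. *)
Lemma Pr_isolated2 j x y : (j <= n)%N -> x != y -> y \in hball j x ->
  Prob (fun w => isolated j x w && isolated j y w) <=
  expR (- \sum_(0 <= l < j) shell l) ^+ 2 * expR (rt x y).
Proof.
move=> jn xy yx; set S := \sum_(0 <= l < j) shell l.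
have -> : Prob (fun w => isolated j x w && isolated j y w) =
          Prob (closed_in (isol_edges j x :|: isol_edges j y)).
  apply: eq_Pr => w; apply/andP/forall_inP => [[/forall_inP cx /forall_inP cy] e|h].
    by rewrite inE => /orP[/cx|/cy].
  by split; apply/forall_inP => e ex; apply: h; rewrite inE ex ?orbT.
rewrite Pr_closed_in// expr2 -!expRD ler_expR.
have SE z : \sum_(e in isol_edges j z) J (edge_len e) = S.
  rewrite sum_cross// big_set1 /S -(sum_rate_shell (m := 0) (j := j) z)//.
  by rewrite hball0.
have [e0 e0E] := mk_edge xy.
have : \sum_(e in isol_edges j y :&: isol_edges j x) J (edge_len e) <= rt x y.
  apply: (@le_trans _ _ (\sum_(e in [set e0]) J (edge_len e))); last first.
    by rewrite big_set1 (edge_len_pair e0E).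
  have sub : isol_edges j y :&: isol_edges j x \subset [set e0].
    apply/subsetP => e; rewrite in_setI => /andP[/crossP[u [v [uy _ eE]]] /crossP[u' [v' [u'x _ eE']]]].
    rewrite inE -val_eqE/= e0E.
    move: uy u'x; rewrite !inE => /eqP uy /eqP u'x; subst u u'.
    have xe : x \in val e by rewrite eE' !inE eqxx.
    move: xe; rewrite eE !inE (negbTE xy)/= => /eqP xv; subst v.
    by rewrite eE setUC.
  by rewrite [leRHS](big_setID (isol_edges j y :&: isol_edges j x))/= (setIidPr sub) lerDl sumr_ge0// => e _; exact: J_edge_ge0.
have -> : \sum_(e in isol_edges j x :|: isol_edges j y) J (edge_len e) =
   S + S - \sum_(e in isol_edges j y :&: isol_edges j x) J (edge_len e).
  rewrite (_ : S + S = \sum_(e in isol_edges j x) J (edge_len e) +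
    \sum_(e in isol_edges j y) J (edge_len e)); last by rewrite !SE.
  rewrite [LHS](big_setID (isol_edges j x))/= setUK setDUl setDv set0U.
  rewrite [X in _ = _ + X - _](big_setID (isol_edges j x))/=.
  by rewrite [X in _ = _ + X - _]addrC addrA addrK.
lra.
Qed.

Variable S : R.
Hypothesis S_bound : forall m, \sum_(0 <= l < m) shell l <= S.

(** What is dense here is the set of isolated vertices: their expected proportion is at least
    [expR (- S)], and the event asks for half of this. *)
Definition dense j w := #|active j w|%:R <= (1 - expR (- S) / 2) * N ^+ j.

Definition conc : R := 4 * (1 + S * expR S) * expR (2 * S).

Let N_gt0 : 0 < N. Proof. by rewrite (lt_le_trans _ (N_ge2 R L2 d1)). Qed.

(** Chebyshev's inequality for the number of isolated vertices. Two isolation events are correlated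
    only through their common edge, so the covariances around a vertex sum to at most [S * expR S]
    and the variance is linear in the volume. *)
Lemma Pr_not_dense j : (j <= n)%N -> Prob (fun w => ~~ dense j w) <= conc / N ^+ j.
Proof.
move=> jn.
set B := hball j origin; set Sj := \sum_(0 <= l < j) shell l.
pose k := expR (- Sj).
have k_ge : expR (- S) <= k by rewrite ler_expR lerN2 S_bound.
have kpos : 0 < expR (- S) by rewrite expR_gt0.
have k1 : k <= 1 by rewrite -expR0 ler_expR oppr_le0; apply: sumr_ge0 => l _; exact: shell_ge0.
pose Y w := \sum_(x in B) ((isolated j x w)%:R - k).
have cardB : #|B|%:R = N ^+ j :> R by rewrite card_hballR.
have Nj : 0 < N ^+ j by rewrite exprn_gt0.
have YE w : Y w = N ^+ j - #|active j w|%:R - k * N ^+ j.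
  rewrite /Y sumrB sumr_const -[X in _ - X]mulr_natr cardB; congr (_ - _).
  have -> : active j w = B :\: [set x | isolated j x w].
    by apply/setP => x; rewrite !inE andbC.
  rewrite cardsD natrB ?subset_leq_card ?subsetIl// cardB opprB addrCA subrr addr0.
  rewrite -sum1_cardR big_mkcond [RHS]big_mkcond.
  by apply: eq_bigr => x _; rewrite !inE; case: (_ <= _)%N => //=; case: isolated.
have rtS x y : x \in B -> y \in B -> x != y -> rt x y <= S.
  move=> xB yB xy; apply: le_trans (S_bound j).
  rewrite -(sum_rate_shell (m := 0) (j := j) x)// hball0.
  have yx : y \in hball j x :\ x.
    by rewrite in_setD1 eq_sym xy (hball_eq xB).
  rewrite (big_setD1 y)//= lerDl sumr_ge0// => z; rewrite !inE => /and3P[_ zx _].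
  by rewrite rate_ge0// eq_sym.
have ExI x : x \in B -> Ex J (fun w => (isolated j x w)%:R) = k.
  by move=> xB; rewrite /k /Sj -(Pr_isolated x jn).
have var : Ex J (fun w => Y w ^+ 2) <= N ^+ j * (1 + S * expR S).
  have -> : Ex J (fun w => Y w ^+ 2) = \sum_(x in B) \sum_(y in B)
     (Prob (fun w => isolated j x w && isolated j y w) - k ^+ 2).
    rewrite (_ : Ex _ _ = Ex J (fun w => \sum_(x in B) \sum_(y in B)
       ((isolated j x w)%:R - k) * ((isolated j y w)%:R - k))); last first.
      apply: eq_Ex => w; rewrite expr2 {1}/Y mulr_suml; apply: eq_bigr => x _.
      by rewrite /Y mulr_sumr.
    rewrite Ex_sum; apply: eq_bigr => x xB; rewrite Ex_sum; apply: eq_bigr => y yB.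
    rewrite (Ex_cov (ExI x xB) (ExI y yB)) expr2; congr (_ - _).
    by apply: eq_Ex => w; rewrite -mulnb natrM.
  rewrite -cardB -sum1_cardR mulr_suml; apply: ler_sum => x xB; rewrite mul1r.
  rewrite (big_setD1 x)//=; apply: lerD.
    by rewrite lerBlDr (le_trans (Pr_le1 J_ge0 _))// lerDl sqr_ge0.
  apply: (@le_trans _ _ (\sum_(y in B :\ x) rt x y * expR S)); last first.
    rewrite -mulr_suml ler_wpM2r ?expR_ge0//.
    have -> : B = hball j x by rewrite (hball_eq xB).
    by rewrite -(hball0 x) sum_rate_shell.
  apply: ler_sum => y; rewrite in_setD1 => /andP[yx yB].
  have xy : x != y by rewrite eq_sym.
  have yBx : y \in hball j x by rewrite (hball_eq xB).
  have := Pr_isolated2 jn xy yBx; rewrite -/Sj -/k => h.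
  apply: (@le_trans _ _ (k ^+ 2 * (expR (rt x y) - 1))).
    by rewrite mulrBr mulr1 lerD2r.
  have r0 : 0 <= rt x y by rewrite rate_ge0.
  have e1 : 1 <= expR (rt x y) by rewrite -expR0 ler_expR.
  apply: (@le_trans _ _ (expR (rt x y) - 1)).
    rewrite ler_piMl ?subr_ge0// expr_le1// expR_ge0//.
  apply: (@le_trans _ _ (rt x y * expR (rt x y))); last first.
    by rewrite ler_wpM2l// ler_expR rtS.
  have := expR_ge1Dx (- rt x y); rewrite expRN => h2.
  have e0 := expR_gt0 (rt x y).
  have : (1 - rt x y) * expR (rt x y) <= 1 by rewrite -ler_pdivlMr// div1r.
  lra.
apply: (@le_trans _ _ (Ex J (fun w => Y w ^+ 2) / (expR (- S) / 2 * N ^+ j) ^+ 2)).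
  apply: markov_ineq => //.
  - by rewrite exprn_gt0// mulr_gt0// divr_gt0.
  - by move=> w; rewrite sqr_ge0.
  (* Since [k >= expR (- S)], a failure of density forces [Y] below minus half of
     [expR (- S) * N ^ j]. *)
  move=> w; rewrite /dense -ltNge => wd.
  rewrite -[leRHS]sqrrN ler_sqr ?nnegrE; first 1 last.
  - by rewrite mulr_ge0 ?divr_ge0// ?ltW.
  - rewrite oppr_ge0 YE; nra.
  - rewrite YE; nra.
rewrite ler_pdivrMr ?exprn_gt0 ?mulr_gt0 ?divr_gt0//.
apply: (le_trans var); rewrite le_eqVlt; apply/orP; left; apply/eqP.
rewrite /conc mulrC (_ : 2 * S = S + S); last by rewrite mulr_natl.
rewrite expRD expRN; field.
by rewrite (gt_eqF Nj) (gt_eqF (expR_gt0 _)).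
Qed.

(** The origin together with the active vertices forms a set closed under open edges: by hypothesis
    none of them leaves the ball, and a vertex reached from another vertex of the ball is not
    isolated. The origin is added separately because it may itself be isolated inside the ball. *)
Lemma small_cluster j w : (j <= n)%N ->
  closed_in (cross (active j w) (~: hball j origin)) w ->
  closed_in (cross [set origin] (~: hball j origin)) w ->
  (#|Defs.cluster w| <= (L ^ d) ^ j)%N.
Proof.
move=> jn clA clo.
have disA : [disjoint active j w & ~: hball j origin].
  by rewrite disjoint_subset; apply/subsetP => x; rewrite !inE negbK => /andP[].
have diso : [disjoint [set origin] & ~: hball j origin].
  by rewrite disjoints1 inE hball_refl.
rewrite -(card_hball origin jn); apply/subset_leq_card/subsetP => y.
rewrite in_cluster => oy.
suff : y \in origin |: active j w.
  by rewrite in_setU1 => /orP[/eqP ->|]; rewrite ?hball_refl// inE => /andP[].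
apply: connect_closed oy; last by rewrite !inE eqxx.
move=> u v uS uv; apply/setU1P.
have [->|vo] := eqVneq v origin; [by left|right].
have [vu|vu] := eqVneq v u; first by move: uS; rewrite -vu in_setU1 (negbTE vo).
have uB : u \in hball j origin.
  by move: uS; rewrite in_setU1 => /orP[/eqP ->|]; rewrite ?hball_refl// inE => /andP[].
have vB : v \in hball j origin.
  apply/negPn/negP => vB; move: uS uv; rewrite in_setU1 => /orP[/eqP -> uv|uA uv].
    by have /closed_crossP := clo => /(_ diso origin v); rewrite !inE eqxx uv -in_hball vB => /(_ isT isT).
  by have /closed_crossP := clA => /(_ disA u v uA); rewrite !inE uv -in_hball vB => /(_ isT).
rewrite inE vB/=; apply/negP => /closed_crossP-/(_ (dis1 _ _) v u).
rewrite set11 in_setD1 eq_sym vu (hball_eq vB) uB => /(_ isT isT).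
by rewrite open_adj_sym uv.
Qed.

Variables (I : nat) (t : nat -> nat) (s : R).
Hypothesis t_mono : {homo t : i j / (i <= j)%N}.
Hypothesis t_n : (t I <= n)%N.
Hypothesis s_ge0 : 0 <= s.
Hypothesis s_bound : forall i, (i < I)%N ->
  (1 - expR (- S) / 2) * N ^+ t i * \sum_(t i <= l < t i.+1) shell l <= s.

Let ring_out i : {set V} := hball (t i.+1) origin :\: hball (t i) origin.
(** Only edges into the next annulus count; jumps beyond it are treated apart. Escapes at successive
    scales are thus read in nested balls. *)
Let escapes i w := ~~ closed_in (cross (active (t i) w) (ring_out i)) w.

Lemma active_sub j w : active j w \subset hball j origin.
Proof. by apply/subsetP => x; rewrite inE => /andP[]. Qed.

Lemma depends_on_active j : depends_on (inside (hball j origin)) (active j).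
Proof.
move=> w w' ww'; apply/setP => x; rewrite !inE -in_hball.
case: (boolP (x \in _)) => //= xB; congr (~~ _).
apply: (depends_onS _ (@depends_on_closed_in _ _ _ _)) ww'.
apply/subsetP => e /crossP[u [v [ux vx eE]]]; rewrite (in_inside _ eE).
move: ux vx; rewrite inE => /eqP ->; rewrite in_setD1 => /andP[_].
by rewrite (hball_eq xB) xB => ->.
Qed.

Let escapes_loc i : depends_on (inside (hball (t i.+1) origin)) (escapes i).
Proof.
move=> w w' ww'; rewrite /escapes; congr (~~ _).
have ii1 : hball (t i) origin \subset hball (t i.+1) origin by rewrite hball_subset ?t_mono.
rewrite (@depends_on_active (t i) w w'); last first.
  by move=> e /(subsetP (insideS ii1)); exact: ww'.
apply: (depends_onS _ (@depends_on_closed_in _ _ _ _)) ww'.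
apply/subsetP => e /crossP[u [v [ux vx eE]]]; rewrite (in_inside _ eE).
rewrite (subsetP ii1) ?(subsetP (active_sub _ _) _ ux)//.
by move: vx; rewrite inE => /andP[].
Qed.

(** The scales are explored one after the other. The events of the earlier scales and the density at
    scale [k] are read inside the ball of level [t k]. The edges from the active set into the next
    annulus are fresh, and by density and [s_bound] they are all closed with conditional probability
    at least [expR (- s)]. *)
Lemma Pr_escapes_all :
  Prob (fun w => [forall i : 'I_I, dense (t i) w && escapes i w]) <= (1 - expR (- s)) ^+ I.
Proof.
pose G k w := [forall i : 'I_I, (i < k)%N ==> dense (t i) w && escapes i w].
suff H k : (k <= I)%N -> Prob (G k) <= (1 - expR (- s)) ^+ k.
  by rewrite (le_trans _ (H I (leqnn _)))// le_Pr// => w /forallP h; apply/forallP => i; rewrite h implybT.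
elim: k => [|k IH] kI; first by rewrite expr0 Pr_le1.
pose P w := G k w && dense (t k) w.
have ldep i k' : (i <= k')%N -> inside (hball (t i) origin) \subset inside (hball (t k') origin).
  by move=> ik; rewrite insideS// hball_subset// t_mono.
have PD : depends_on (inside (hball (t k) origin)) P.
  have dd i : (i <= k)%N -> depends_on (inside (hball (t k) origin)) (dense (t i)).
    move=> ik w w' ww'; rewrite /dense; congr (_%:R <= _); congr (#|pred_of_set _|).
    by apply: depends_on_active => e /(subsetP (ldep _ _ ik)); exact: ww'.
  move=> w w' ww'; rewrite /P (dd k (leqnn _) _ _ ww'); congr (_ && _).
  apply: eq_forallb => i; case: ltnP => //= ik.
  rewrite (dd i (ltnW ik) _ _ ww') (@escapes_loc i w w')// => e.
  by move=> /(subsetP (ldep _ _ ik)); exact: ww'.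
have -> : Prob (G k.+1) = Prob P - Prob (fun w => P w && ~~ escapes k w).
  rewrite /Pr -ExB; apply: eq_Ex => w.
  have -> : G k.+1 w = P w && escapes k w.
    rewrite /P /G -andbA; apply/forallP/andP => [h|[/forallP h1 h2] i].
      split; last by have := h (Ordinal kI); rewrite /= ltnS leqnn.
      by apply/forallP => i; apply/implyP => ik; have /implyP := h i; rewrite ltnS; apply; exact: ltnW.
    rewrite ltnS; apply/implyP; rewrite leq_eqVlt => /orP[/eqP ->//|ik].
    by have /implyP := h1 i; exact.
  by case: (P w); case: (escapes k w); rewrite /= ?subrr ?subr0.
have disk w : [disjoint active (t k) w & ring_out k].
  by rewrite disjoint_subset; apply/subsetP => x /(subsetP (active_sub _ _)); rewrite !inE -!in_hball => ->.
have := @Pr_no_cross_ge R d L n J J_ge0 (inside (hball (t k) origin)) (active (t k)) (fun=> ring_out k) P PD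
   (@depends_on_active (t k)) (fun _ _ _ => erefl) disk _ s.
have disE w : [disjoint cross (active (t k) w) (ring_out k) & inside (hball (t k) origin)].
  apply: cross_disjoint_inside; rewrite disjoint_subset; apply/subsetP => x.
  by rewrite !inE => /andP[].
move=> /(_ disE) H.
have {}H : Prob P * expR (- s) <= Prob (fun w => P w && ~~ escapes k w).
  apply: le_trans (H _) _; last first.
    by apply: (le_Pr J_ge0) => w /andP[-> /= ?]; rewrite negbK.
  move=> w /andP[_ dw]; apply: le_trans (s_bound kI).
  have tk1 : (t k <= t k.+1 <= n)%N by rewrite !t_mono//= (leq_trans _ t_n)// t_mono.
  apply: (@le_trans _ _ (\sum_(x in active (t k) w) \sum_(t k <= l < t k.+1) shell l)).
    apply: ler_sum => x /(subsetP (active_sub _ _)) xB.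
    rewrite -(sum_rate_shell x tk1) /ring_out (hball_eq xB).
    by rewrite (hball_eq (subsetP (hball_subset _ (t_mono (leqnSn k))) _ xB)).
  rewrite sumr_const -[leLHS]mulr_natl ler_wpM2r// sumr_ge0// => l _; exact: shell_ge0.
have PG : Prob P <= Prob (G k) by apply: (le_Pr J_ge0) => w /andP[].
have es1 : expR (- s) <= 1 by rewrite -expR0 ler_expR oppr_le0.
rewrite exprS.
have := IH (ltnW kI); have := Pr_ge0 J_ge0 P => *.
have : (1 - expR (- s)) * Prob P <= (1 - expR (- s)) * (1 - expR (- s)) ^+ k.
  by rewrite ler_wpM2l ?subr_ge0//; apply: le_trans PG _.
lra.
Qed.

Variable tail : nat -> R.
Hypothesis tail_bound : forall m m', (m <= m')%N ->
  \sum_(m <= l < m') shell l <= tail m.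

(* If the cluster is larger than the ball of level [t I], then at every scale
   either the active set escapes to the next ball, or an edge jumps over the
   whole annulus, or the origin is isolated in the ball but not outside. *)
Lemma Pr_large_cluster :
  Prob (fun w => ((L ^ d) ^ t I < #|Defs.cluster w|)%N) <=
  \sum_(i < I) (conc / N ^+ t i + N ^+ t i * tail (t i.+1) + tail (t i)) +
  (1 - expR (- s)) ^+ I.
Proof.
have tn i : (i <= I)%N -> (t i <= n)%N by move=> iI; rewrite (leq_trans _ t_n) ?t_mono.
pose B i := hball (t i) origin.
pose bad (i : 'I_I) w := [|| ~~ dense (t i) w,
  ~~ closed_in (cross (B i) (~: B i.+1)) w | ~~ closed_in (cross [set origin] (~: B i)) w].
have BB i : B i \subset B i.+1 by rewrite hball_subset ?t_mono.
apply: (@le_trans _ _ (Prob (fun w => [exists i in 'I_I, bad i w] ||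
    [forall i : 'I_I, dense (t i) w && escapes i w]))).
  apply: (le_Pr J_ge0) => w big; apply/orP.
  have [?|ok] := boolP [exists i in 'I_I, bad i w]; [by left|right].
  apply/forallP => i.
  have : ~~ bad i w by apply: contra ok => bi; apply/exists_inP; exists i.
  rewrite !negb_or !negbK => /and3P[-> cl clo] /=.
  apply/negP => cle; move: big; rewrite ltnNge => /negP; apply.
  have iI : (i <= I)%N by exact: ltnW.
  apply: leq_trans (small_cluster (tn _ iI) _ clo) _; last first.
    by rewrite leq_exp2l ?t_mono//; have := N_ge2 R L2 d1; rewrite ler_nat.
  apply/forall_inP => e /crossP[u [v [ua vB eE]]].
  have [vB1|vB1] := boolP (v \in B i.+1).
    move/forall_inP: cle; apply; apply/crossP; exists u, v; split=> //.
    by rewrite in_setD vB1 andbT; move: vB; rewrite in_setC.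
  move/forall_inP: cl; apply; apply/crossP; exists u, v; split=> //.
    exact: (subsetP (active_sub _ _)) ua.
  by rewrite in_setC.
apply: le_trans (PrU J_ge0 _ _) _; apply: lerD; last exact: Pr_escapes_all.
apply: le_trans (Pr_exists J_ge0 _ _) _; apply: ler_sum => i _.
have iI : (i <= I)%N by exact: ltnW.
have iI1 : (i.+1 <= I)%N by [].
have disB k k' : (k <= k')%N -> [disjoint B k & ~: B k'].
  move=> kk'; rewrite disjoint_subset; apply/subsetP => x xB.
  by rewrite inE /= in_setC negbK; apply: subsetP xB; rewrite hball_subset ?t_mono.
have outE k x : (t k <= n)%N -> x \in B k -> \sum_(y in ~: B k) rt x y = \sum_(t k <= l < n) shell l.
  move=> kn xB; rewrite -(@sum_rate_shell (t k) n x) ?kn ?leqnn//.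
  by rewrite hball_full// setTD (hball_eq xB).
apply: le_trans (PrU J_ge0 _ _) _; rewrite -addrA; apply: lerD.
  exact/Pr_not_dense/tn.
apply: le_trans (PrU J_ge0 _ _) _; apply: lerD.
  apply: le_trans (Pr_some_cross J (disB _ _ (leqnSn i))) _.
  apply: (@le_trans _ _ (\sum_(x in B i) tail (t i.+1))).
    apply: ler_sum => x xB; rewrite outE ?tn// ?(subsetP (BB i))//.
    exact/tail_bound/tn.
  by rewrite sumr_const -[leLHS]mulr_natl card_hballR ?tn.
have diso : [disjoint [set origin] & ~: B i] by rewrite disjoints1 inE hball_refl.
apply: le_trans (Pr_some_cross J diso) _.
by rewrite big_set1 outE ?tail_bound ?tn ?hball_refl.
Qed.

End Subcritical.

(** * Kernel bounds from the limsup condition and choice of the scales *)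

Section SubcriticalLimit.
Variables (R : realType) (d L : nat) (J : nat -> R).
Hypothesis L2 : (2 <= L)%N.
Hypothesis d1 : (1 <= d)%N.
Hypothesis J_ge0 : forall k, (1 <= k)%N -> 0 <= J (L ^ k)%N.
Notation N := ((L ^ d)%N%:R : R).

Let N_ge2 : 2 <= N. Proof. exact: N_ge2. Qed.
Let N_gt0 : 0 < N. Proof. exact: lt_le_trans N_ge2. Qed.
Let N_ge1 : 1 <= N. Proof. by rewrite (le_trans _ N_ge2)// ler1n. Qed.

Notation Shell := (@shell R d L J).

Lemma prob_cluster_geE n m :
  prob_cluster_ge d L J n m = Pr J (fun w : config d L n => (m <= #|Defs.cluster w|)%N).
Proof. by rewrite PrE. Qed.

Lemma perc_prob_eq0 : (forall e : R, 0 < e -> exists m, forall n,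
  prob_cluster_ge d L J n m <= e) -> perc_prob d L J = 0.
Proof.
move=> small.
pose A m : set R := [set p | exists n : nat, p = prob_cluster_ge d L J n m]%classic.
have Ane m : (A m !=set0)%classic by exists (prob_cluster_ge d L J 0 m); exists 0%N.
have Age m p : A m p -> 0 <= p <= 1.
  by move=> [n ->]; rewrite prob_cluster_geE Pr_ge0 ?Pr_le1.
have supA m : 0 <= sup (A m).
  apply: (@le_trans _ _ (prob_cluster_ge d L J 0 m)).
    by rewrite prob_cluster_geE Pr_ge0.
  apply: ub_le_sup; last by exists 0%N.
  by exists 1 => p /Age /andP[].
apply/eqP; rewrite eq_le; apply/andP; split; last first.
  have ne : ([set s | exists k, s = sup (A k)] !=set0)%classic.
    by exists (sup (A 0%N)), 0%N.
  by apply: (lb_le_inf ne) => _ [m ->].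
apply/ler_addgt0Pl => e e0; rewrite addr0.
have [m me] := small e e0.
apply: (@le_trans _ _ (sup (A m))).
  have lbA : has_lbound [set s | exists k, s = sup (A k)]%classic.
    by exists 0 => _ [k ->].
  exact: (ge_inf lbA (ex_intro _ m erefl)).
by apply: ge_sup => // p [n ->].
Qed.

Lemma limn_esup_le_eventually (u : nat -> R) : (limn_esup (fun n => (u n)%:E) <= 1%:E)%E ->
  forall e, 0 < e -> exists m, forall n, (m <= n)%N -> u n <= 1 + e.
Proof.
move=> lim1 e e0.
have : (limn_esup (fun n => (u n)%:E) < (1 + e)%:E)%E.
  by rewrite (le_lt_trans lim1)// lte_fin ltrDl.
rewrite /limn_esup /limf_esup => /ereal_inf_lt[_ [V [m _ mV] <-]] VS.
exists m => n mn; rewrite -lee_fin; apply: le_trans (ltW VS).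
by apply: ereal_sup_ubound; exists n => //; exact: mV.
Qed.

Hypothesis J_limsup : (limn_esup (fun n : nat =>
  ((L%:R) ^- d * ((L ^ n)%N%:R) ^+ (2 * d) / ln (ln ((L ^ n)%N%:R)) * J (L ^ n)%N)%:E) <= 1%:E)%E.

Let lnL_gt0 : 0 < ln (L%:R : R). Proof. by rewrite ln_gt0// ltr1n. Qed.

Lemma ln_LX n : ln ((L ^ n)%N%:R : R) = n%:R * ln L%:R.
Proof. by rewrite natrX lnXn ?ltr0n ?(ltnW L2)// mulr_natl. Qed.

Lemma J_eventually e : 0 < e -> exists m, forall n, (m <= n)%N ->
  J (L ^ n)%N <= (1 + e) * (N / N ^+ (2 * n)) * ln (n%:R * ln L%:R).
Proof.
move=> e0; have [m0 hm0] := limn_esup_le_eventually J_limsup e0.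
(* Beyond [m1] the iterated logarithm is positive, so that the limsup bound can be multiplied by
   it. *)
have [m1 hm1] : exists m1, (ln (L%:R : R))^-1 < m1%:R.
  by exists (Num.bound (ln (L%:R : R))^-1); rewrite archi_boundP// invr_ge0 ltW.
exists (maxn m0 m1) => n; rewrite geq_max => /andP[m0n m1n].
have nl : 1 < n%:R * ln (L%:R : R).
  by rewrite -ltr_pdivrMr// div1r (lt_le_trans hm1)// ler_nat.
have ll0 : 0 < ln (n%:R * ln (L%:R : R)) by rewrite ln_gt0.
have := hm0 n m0n; rewrite ln_LX => h.
have -> : N / N ^+ (2 * n) = ((L%:R) ^- d * ((L ^ n)%N%:R) ^+ (2 * d))^-1 :> R.
  rewrite invfM invrK !natrX -!exprM; congr (_ / _ ^+ _); lia.
set X := (_ * _ ^+ _ : R) in h *.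
have X0 : 0 < X by rewrite mulr_gt0 ?invr_gt0 ?exprn_gt0// ltr0n// ?expn_gt0 ltnW.
have XL : 0 < X / ln (n%:R * ln (L%:R : R)) by rewrite divr_gt0.
move: h; rewrite mulrC -ler_pdivlMr// => /le_trans; apply.
by rewrite invfM invrK mulrA.
Qed.

(** A crude bound valid at every level: [ln x <= x] handles the large levels, and the finitely many
    others are absorbed into the constant. It serves for the total rate at a vertex and for the
    tails; the sharp constant enters through [sum_shell_window]. *)
Lemma J_bound : exists2 C : R, 0 < C & forall l, (1 <= l)%N ->
  J (L ^ l)%N <= C * l%:R / N ^+ (2 * l).
Proof.
have [m hm] := J_eventually ltr01.
pose C := \sum_(l < m) J (L ^ l.+1)%N * N ^+ (2 * l.+1) + 2 * N * L%:R.
have S0 : 0 <= \sum_(l < m) J (L ^ l.+1)%N * N ^+ (2 * l.+1).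
  by apply: sumr_ge0 => l _; rewrite mulr_ge0 ?J_ge0// exprn_ge0// ltW.
have C0 : 0 < C by rewrite ltr_wpDl// !mulr_gt0// ltr0n ltnW.
exists C => // l l1.
have Nl : 0 < N ^+ (2 * l) by rewrite exprn_gt0.
rewrite ler_pdivlMr//.
have l1R : 1 <= l%:R :> R by rewrite ler1n.
have [ml|lm] := leqP m l; last first.
  case: l l1 lm Nl l1R => // l _ lm Nl l1R.
  apply: (@le_trans _ _ C); last by rewrite ler_peMr// ltW.
  rewrite /C (bigD1 (Ordinal (ltnW lm)))//= -addrA lerDl addr_ge0 ?mulr_ge0// ?ler0n ?(ltW N_gt0)//.
  by apply: sumr_ge0 => k _; rewrite mulr_ge0 ?J_ge0// exprn_ge0// ltW.
have := hm l ml; rewrite -(ler_pM2r Nl) => /le_trans; apply.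
rewrite (_ : (1 + 1) * (N / N ^+ (2 * l)) * ln (l%:R * ln L%:R) * N ^+ (2 * l) =
  2 * N * ln (l%:R * ln L%:R)); last by field; rewrite gt_eqF.
have lnle (x : R) : 0 < x -> ln x <= x.
  by move=> x0; rewrite -ler_expR lnK ?posrE//; have := expR_ge1Dx x; lra.
have L0 : 0 < L%:R :> R by rewrite ltr0n ltnW.
apply: (@le_trans _ _ (2 * N * (l%:R * L%:R))).
  rewrite ler_wpM2l ?mulr_ge0 ?(ltW N_gt0)//.
  apply: le_trans (lnle _ _) _; first by rewrite mulr_gt0// ltr0n.
  by rewrite ler_wpM2l ?ler0n// lnle.
rewrite [l%:R * _]mulrC mulrA ler_wpM2r ?ler0n// /C lerDr//.
Qed.


(** Telescoping: from [l] to [l.+1] the quantity [C * (l + 2) / N ^ l] drops by at least the bound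
    on [shell l], and this amounts exactly to [N >= 2]. *)
Lemma sum_shell_le C : 0 < C ->
  (forall l, (1 <= l)%N -> J (L ^ l)%N <= C * l%:R / N ^+ (2 * l)) ->
  forall m m', (m <= m')%N ->
  \sum_(m <= l < m') Shell l <= C * (m%:R + 2) / N ^+ m.
Proof.
move=> C0 JC m m' mm'.
pose g l : R := C * (l%:R + 2) / N ^+ l.
have g0 l : 0 <= g l.
  by rewrite /g divr_ge0 ?mulr_ge0 ?addr_ge0 ?ler0n ?exprn_ge0 ?(ltW C0) ?(ltW N_gt0).
apply: (@le_trans _ _ (g m - g m')); last by rewrite lerBlDr lerDl.
rewrite -opprB -(telescope_sumr g mm') -sumrN; apply: ler_sum => l _.
have Nl : 0 < N ^+ l by rewrite exprn_gt0.
apply: (@le_trans _ _ (N ^+ l.+1 * (C * l.+1%:R / N ^+ (2 * l.+1)))).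
  rewrite /shell; apply: ler_pM; rewrite ?subr_ge0 ?J_ge0 ?JC ?lerBlDr ?lerDl ?(ltW Nl)//.
  by rewrite ler_weXn2l.
rewrite /g mulnC exprM expr2 exprS.
have -> : N * N ^+ l * (C * l.+1%:R / (N * N ^+ l * (N * N ^+ l))) = C / N ^+ l * (l.+1%:R / N).
  by field; rewrite !gt_eqF.
have -> : - (C * (l.+1%:R + 2) / (N * N ^+ l) - C * (l%:R + 2) / N ^+ l) =
   C / N ^+ l * (l%:R + 2 - (l.+1%:R + 2) / N).
  by field; rewrite !gt_eqF.
rewrite ler_wpM2l ?divr_ge0 ?(ltW C0) ?(ltW Nl)// lerBrDr -mulrDl ler_pdivrMr//.
rewrite -natr1; have : 0 <= l%:R :> R by rewrite ler0n.
move: l%:R N_ge2 => y; nra.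
Qed.

(** Up to level [T] the logarithm is at most [Lam]. Once it is frozen at this value the rates
    telescope exactly, each shell contributing the difference of [1 / N ^ l] between two successive
    levels. *)
Lemma sum_shell_window e (T m m' : nat) Lam : 0 < e ->
  (forall l, (m < l)%N -> J (L ^ l)%N <= (1 + e) * (N / N ^+ (2 * l)) * ln (l%:R * ln L%:R)) ->
  (m <= m' <= T)%N -> 0 <= Lam -> ln (T%:R * ln L%:R) <= Lam ->
  \sum_(m <= l < m') Shell l <= (1 + e) * Lam / N ^+ m.
Proof.
move=> e0 JC /andP[mm' m'T] Lam0 TLam.
pose g l : R := (1 + e) * Lam / N ^+ l.
have e1 : 0 <= 1 + e by rewrite addr_ge0// ltW.
have g0 l : 0 <= g l by rewrite /g divr_ge0 ?mulr_ge0 ?exprn_ge0 ?(ltW N_gt0).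
apply: (@le_trans _ _ (g m - g m')); last by rewrite lerBlDr lerDl.
rewrite -opprB -(telescope_sumr g mm') -sumrN big_nat [leRHS]big_nat.
apply: ler_sum => l /andP[ml lm'].
have Nl : 0 < N ^+ l by rewrite exprn_gt0.
have lLam : ln (l.+1%:R * ln (L%:R : R)) <= Lam.
  apply: le_trans TLam; rewrite ler_ln ?posrE ?mulr_gt0 ?ltr0n//; last first.
    by rewrite (leq_trans _ (leq_trans lm' m'T)).
  by rewrite ler_wpM2r ?(ltW lnL_gt0)// ler_nat (leq_trans lm').
apply: (@le_trans _ _ ((N ^+ l.+1 - N ^+ l) * ((1 + e) * (N / N ^+ (2 * l.+1)) * Lam))).
  rewrite /shell ler_wpM2l ?subr_ge0 ?ler_weXn2l//.
  apply: le_trans (JC _ _) _ => //; rewrite ler_wpM2l//.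
  by apply: mulr_ge0 => //; apply: divr_ge0; rewrite ?exprn_ge0 ?(ltW N_gt0).
rewrite /g mulnC exprM expr2 exprS le_eqVlt; apply/orP; left; apply/eqP.
by field; rewrite !gt_eqF.
Qed.

Lemma leq_8exp2 j : (6 <= j)%N -> (8 * j <= 2 ^ j)%N.
Proof.
elim: j => // j IH; rewrite leq_eqVlt => /orP[/eqP <- //|j6].
by have := IH j6; rewrite expnS; lia.
Qed.

(* With [t i = 2 ^ j + 4 * j * i], there are about [2 ^ j / (4 j)] scales below
   [2 ^ j.+1], each succeeding with probability at least [2 ^ (- (1 - dl) j)]
   up to a constant. *)
Lemma geometric_decay (dl Lam : R) (j I : nat) : 0 < dl <= 1 ->
  Lam = ln (2 ^+ j.+1 * L%:R) -> (6 <= j)%N -> (2 ^ j < I.+1 * (4 * j))%N ->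
  (1 - expR (- ((1 - dl) * Lam))) ^+ I <= ((dl * ln 2) ^+ 2 / (32 * L%:R) * j%:R)^-1.
Proof.
move=> /andP[dl0 dl1] LamE j6 Ij; set c := (dl * ln 2) ^+ 2 / (32 * L%:R).
have L0 : 0 < L%:R :> R by rewrite ltr0n ltnW.
have j0 : 0 < j%:R :> R by rewrite ltr0n (leq_trans _ j6).
have ln2 : 0 < ln (2 : R) by rewrite ln_gt0// ltr1n.
have c0 : 0 < c by rewrite /c divr_gt0 ?exprn_gt0 ?mulr_gt0.
set s := (1 - dl) * Lam.
have PE : 2 ^+ j = expR (j%:R * ln 2) :> R by rewrite expRM_natl lnK ?posrE.
have P8 : 8 * j%:R <= 2 ^+ j :> R by rewrite -natrX -natrM ler_nat leq_8exp2.
have I_ge : 2 ^+ j / (8 * j%:R) <= I%:R :> R.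
  have : 2 ^+ j <= I.+1%:R * (4 * j%:R) :> R by rewrite -natrX -!natrM ler_nat ltnW.
  rewrite -[I.+1%:R]natr1 ler_pdivrMr ?mulr_gt0//; move: P8 j0.
  by move: (2 ^+ j) I%:R j%:R => p i y; lra.
have es : expR (dl * (j%:R * ln 2)) / (2 * L%:R) <= 2 ^+ j * expR (- s).
  rewrite PE -expRD -[2 * L%:R]lnK ?posrE ?mulr_gt0// -expRN -expRD ler_expR.
  rewrite /s LamE lnM ?posrE ?exprn_gt0// lnXn// lnM ?posrE// -[_ *+ j.+1]mulr_natl -[j.+1%:R]natr1.
  have lnL0 : 0 < ln (L%:R : R) by rewrite ln_gt0// ltr1n.
  have : 0 <= dl * (ln 2 + ln L%:R) by rewrite mulr_ge0 ?addr_ge0 ?ltW.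
  move: (j%:R) (ln (2 : R)) (ln (L%:R : R)) => y a b; lra.
have y0 : 0 <= dl * (j%:R * ln 2) by rewrite !mulr_ge0 ?ltW.
have Ies : c * j%:R <= I%:R * expR (- s).
  apply: (@le_trans _ _ (2 ^+ j / (8 * j%:R) * expR (- s))); last first.
    by rewrite ler_wpM2r ?expR_ge0.
  rewrite [leRHS]mulrAC ler_pdivlMr ?mulr_gt0//; apply: le_trans es.
  rewrite ler_pdivlMr ?mulr_gt0//.
  (* A quadratic lower bound on the exponential: one factor [j] is lost in the number of scales and
     one must remain. *)
  have := expR_ge1Dxn 1 y0; rewrite (_ : 2`!%:R = 2)// => h.
  apply: le_trans h; rewrite /c exprMn.
  rewrite (_ : _ * (2 * L%:R) = (dl * (j%:R * ln 2)) ^+ 2 / 2); last by field; rewrite gt_eqF.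
  by rewrite lerDr.
have es1 : 0 <= 1 - expR (- s).
  rewrite subr_ge0 -expR0 ler_expR oppr_le0 /s mulr_ge0 ?subr_ge0//.
  have L1 : 1 <= L%:R :> R by rewrite ler1n ltnW.
  by rewrite LamE ln_ge0// mulr_ege1// exprn_ege1// ler1n.
(* With [p = expR (- s)], one has [(1 - p) ^ I <= expR (- (I * p))], and
   [c * j <= I * p <= expR (I * p)]. *)
apply: (@le_trans _ _ (expR (I%:R * (- expR (- s))))).
  rewrite expRM_natl lerXn2r ?nnegrE ?expR_ge0//; exact: expR_ge1Dx.
rewrite mulrN expRN lef_pV2 ?posrE ?expR_gt0 ?(mulr_gt0 c0 j0)//.
by have := expR_ge1Dx (I%:R * expR (- s)); lra.
Qed.

Lemma subcritical_perc_prob_eq0 : perc_prob d L J = 0.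
Proof.
have [C C0 JC] := J_bound.
pose S := 2 * C; have S_bound m : \sum_(0 <= l < m) Shell l <= S.
  by have := sum_shell_le C0 JC (leq0n m); rewrite add0r expr0 divr1 mulrC.
pose k := expR (- S); have k0 : 0 < k by rewrite expR_gt0.
have k1 : k <= 1 by rewrite -expR0 ler_expR oppr_le0 mulr_ge0// ltW.
(* The slack [k / 2] in the kernel equals the proportion gained from isolated vertices, and
   [(1 - k / 2) * (1 + k / 2) = 1 - dl] stays below 1. *)
have [m1 Jev] := J_eventually (divr_gt0 k0 (ltr0Sn _ 1)).
pose dl := k ^+ 2 / 4.
have dl01 : 0 < dl <= 1 by rewrite /dl; apply/andP; split; nra.
have ln2 : 0 < ln (2 : R) by rewrite ln_gt0// ltr1n.
have L0 : 0 < L%:R :> R by rewrite ltr0n ltnW.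
pose c := (dl * ln 2) ^+ 2 / (32 * L%:R).
have c0 : 0 < c.
  by case/andP: dl01 => ? _; rewrite /c divr_gt0 ?exprn_gt0 ?mulr_gt0.
pose A := conc S + 8 * C.
have conc0 : 0 <= conc S.
  by rewrite /conc !mulr_ge0 ?addr_ge0 ?mulr_ge0 ?expR_ge0// ltW.
have A0 : 0 < A by rewrite /A ltr_wpDl// mulr_gt0.
apply: perc_prob_eq0 => e e0.
have [j [j6 jm1 je]] : exists j : nat,
    [/\ (6 <= j)%N, (m1 <= j)%N & (A + c^-1) / j%:R <= e].
  exists (maxn (maxn 6 m1) (Num.bound ((A + c^-1) / e))).
  split; rewrite ?leq_max ?leqnn ?orbT//.
  rewrite ler_pdivrMr ?ltr0n ?leq_max// mulrC -ler_pdivrMr//.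
  apply: le_trans (ltW (archi_boundP _)) _.
    apply: divr_ge0 (ltW e0); apply: addr_ge0 (ltW A0) _; rewrite invr_ge0; exact: ltW.
  by rewrite ler_nat leq_max leqnn orbT.
have j0 : 0 < j%:R :> R by rewrite ltr0n (leq_trans _ j6).
have P8 := leq_8exp2 j6.
have jP : (j <= 2 ^ j)%N by rewrite ltnW// ltn_expl.
(* All scales lie between [P = 2 ^ j] and [2 * P]. The gap [4 * j] makes [N ^ (4 * j)] at least
   [P ^ 4], so each scale has an error at most [A * P / P ^ 4]; with at most [P] scales the errors
   add up to at most [A / P ^ 2]. *)
pose I := (2 ^ j %/ (4 * j))%N.
pose t i := (2 ^ j + 4 * j * i)%N.
have tmono : {homo t : i i' / (i <= i')%N}.
  by move=> i i' ii'; rewrite leq_add2l leq_mul2l ii' orbT.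
have tI i : (i <= I)%N -> (t i <= 2 ^ j.+1)%N.
  move=> iI; rewrite /t expnS mul2n -addnn leq_add2l mulnC.
  by apply: leq_trans (leq_divM (2 ^ j) (4 * j)); rewrite leq_mul2r iI orbT.
exists (((L ^ d) ^ t I).+1) => n; rewrite prob_cluster_geE.
(* In a smaller box the threshold exceeds the number of vertices, so the event is empty. *)
have [tn|nt] := leqP (t I) n; last first.
  rewrite (_ : Pr _ _ = 0); first exact: ltW.
  rewrite -(Ex_cst d L n J 0); apply: eq_Ex => w; apply/eqP; rewrite pnatr_eq0 eqb0 -leqNgt.
  apply: (@leq_trans #|[set: vert d L n]|).
    by rewrite subset_leq_card// subsetT.
  rewrite -(hball_full (origin d n L2) (leqnn n)) card_hball//.
  by apply: leq_pexp2l (ltnW nt); rewrite expn_gt0 ltnW.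
pose Lam : R := ln (2 ^+ j.+1 * L%:R).
have Lam0 : 0 <= Lam.
  have L1 : 1 <= L%:R :> R by rewrite ler1n ltnW.
  by rewrite /Lam ln_ge0// mulr_ege1// exprn_ege1// ler1n.
have s_ge0 : 0 <= (1 - dl) * Lam.
  by case/andP: dl01 => _ ?; rewrite mulr_ge0// subr_ge0.
have s_bound i : (i < I)%N ->
    (1 - expR (- S) / 2) * N ^+ t i * \sum_(t i <= l < t i.+1) Shell l <= (1 - dl) * Lam.
  move=> iI; have Nt : 0 < N ^+ t i by rewrite exprn_gt0.
  have tt : (t i <= t i.+1 <= 2 ^ j.+1)%N by rewrite tmono//= tI.
  have := @sum_shell_window (k / 2) (2 ^ j.+1) (t i) (t i.+1) Lam (divr_gt0 k0 (ltr0Sn _ 1)) _ tt Lam0.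
  have Jt l : (t i < l)%N -> J (L ^ l)%N <= (1 + k / 2) * (N / N ^+ (2 * l)) * ln (l%:R * ln L%:R).
    by move=> tl; apply: Jev; rewrite (leq_trans jm1)// (leq_trans jP)// (leq_trans _ (ltnW tl))// leq_addr.
  move=> /(_ Jt).
  have TL : ln ((2 ^ j.+1)%N%:R * ln (L%:R : R)) <= Lam.
    rewrite /Lam natrX ler_ln ?posrE ?mulr_gt0 ?exprn_gt0// ler_wpM2l ?exprn_ge0//.
    by rewrite -ler_expR lnK ?posrE//; have := expR_ge1Dx (L%:R : R); lra.
  move=> /(_ TL); rewrite -/k => sumle.
  have k2 : 0 <= 1 - k / 2 by lra.
  apply: (@le_trans _ _ ((1 - k / 2) * N ^+ t i * ((1 + k / 2) * Lam / N ^+ t i))).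
    by rewrite ler_wpM2l// mulr_ge0// ltW.
  rewrite (_ : _ * _ * _ = (1 - dl) * Lam)// /dl.
  by field; rewrite gt_eqF.
have tail_bound m m' : (m <= m')%N -> \sum_(m <= l < m') Shell l <= C * (m%:R + 2) / N ^+ m.
  exact: sum_shell_le.
have := @Pr_large_cluster R d L n J L2 d1 J_ge0 S S_bound I t _ tmono tn s_ge0 s_bound _ tail_bound.
move=> /le_trans; apply.
have I_lt : (2 ^ j < I.+1 * (4 * j))%N by rewrite ltn_ceil// muln_gt0 (leq_trans _ j6).
apply: le_trans je; rewrite [leRHS]mulrDl; apply: lerD; last first.
  by have := geometric_decay dl01 erefl j6 I_lt; rewrite -/Lam -/c invfM.
pose P : R := 2 ^+ j.
have P0 : 0 < P by rewrite exprn_gt0.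
have P1 : 1 <= P by rewrite exprn_ege1// ler1n.
have NP : P ^+ 4 <= N ^+ (4 * j).
  by rewrite /P -exprM mulnC lerXn2r ?nnegrE// ltW.
have P40 : 0 < P ^+ 4 by rewrite exprn_gt0.
have term i : (i < I)%N ->
    conc S / N ^+ t i + N ^+ t i * (C * ((t i.+1)%:R + 2) / N ^+ t i.+1) +
    C * ((t i)%:R + 2) / N ^+ t i <= A * P / P ^+ 4.
  move=> iI.
  have N4 : N ^+ (4 * j) <= N ^+ t i.
    by rewrite ler_weXn2l// /t (leq_trans _ (leq_addr _ _))// (leq_trans _ P8)// leq_mul2r orbT.
  have inv4 : (N ^+ t i)^-1 <= (P ^+ 4)^-1.
    by rewrite lef_pV2 ?posrE ?exprn_gt0// (le_trans NP).
  have tP i' : (i' <= I)%N -> (t i')%:R + 2 <= 4 * P.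
    move=> i'I; have : (t i')%:R <= 2 * P by rewrite /P -exprS -natrX ler_nat tI.
    by lra.
  have tb := tP _ (ltnW iI); have tb1 := tP _ iI.
  have h1 : conc S / N ^+ t i <= conc S * P / P ^+ 4.
    rewrite -mulrA ler_wpM2l// (le_trans inv4)// ler_peMl// invr_ge0 ltW//.
  have h2 : N ^+ t i * (C * ((t i.+1)%:R + 2) / N ^+ t i.+1) <= 4 * C * P / P ^+ 4.
    have tS : t i.+1 = (t i + 4 * j)%N by rewrite /t mulnS addnCA [RHS]addnC.
    rewrite tS.
    have -> : N ^+ t i * (C * ((t i + 4 * j)%N%:R + 2) / N ^+ (t i + 4 * j)) =
        C * ((t i + 4 * j)%N%:R + 2) / N ^+ (4 * j).
      by rewrite exprD; field; rewrite !gt_eqF ?exprn_gt0.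
    rewrite -tS.
    rewrite ler_pM ?mulr_ge0 ?invr_ge0 ?addr_ge0 ?ler0n ?exprn_ge0 ?(ltW C0) ?(ltW N_gt0)//.
      by rewrite (mulrC 4) -mulrA ler_wpM2l// ltW.
    by rewrite lef_pV2 ?posrE ?exprn_gt0.
  have h3 : C * ((t i)%:R + 2) / N ^+ t i <= 4 * C * P / P ^+ 4.
    rewrite ler_pM ?mulr_ge0 ?invr_ge0 ?addr_ge0 ?ler0n ?exprn_ge0 ?(ltW C0) ?(ltW N_gt0)//.
    by rewrite (mulrC 4) -mulrA ler_wpM2l// ltW.
  rewrite /A mulrDl mulrDl; lra.
apply: (@le_trans _ _ (\sum_(i < I) A * P / P ^+ 4)).
  by apply: ler_sum => i _; exact: term.
rewrite sumr_const card_ord -[leLHS]mulr_natl.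
apply: (@le_trans _ _ (P * (A * P / P ^+ 4))).
  rewrite ler_wpM2r ?divr_ge0 ?mulr_ge0 ?(ltW A0) ?(ltW P0) ?(ltW P40)//.
  by rewrite /P -natrX ler_nat leq_div.
rewrite (_ : P * _ = A * (P ^+ 2)^-1); last by field; rewrite gt_eqF.
rewrite ler_wpM2l ?(ltW A0)// lef_pV2 ?posrE ?exprn_gt0//.
apply: (@le_trans _ _ P); first by rewrite /P -natrX ler_nat.
by rewrite expr2 ler_peMl// ltW.
Qed.

End SubcriticalLimit.

(** * Percolation for [a > 1] *)

Section Supercritical.
Variables (R : realType) (d L n : nat) (J : nat -> R).
Hypothesis L2 : (2 <= L)%N.
Hypothesis d1 : (1 <= d)%N.
Hypothesis J_ge0 : forall k, (1 <= k)%N -> 0 <= J (L ^ k)%N.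
Notation V := (vert d L n).
Notation E := (edge d L n).
Notation C := (config d L n).
Notation N := ((L ^ d)%N%:R : R).
Notation Prob := (@Pr R d L n J).
Notation Exp := (@Ex R d L n J).
Notation rt := (@rate R d L n J).
Implicit Types (x y z : V) (e : E) (w : C) (A T : {set V}).

Let N_ge2 : 2 <= N. Proof. exact: N_ge2. Qed.
Let N_gt0 : 0 < N. Proof. exact: lt_le_trans N_ge2. Qed.
Let NX_gt0 j : 0 < N ^+ j. Proof. by rewrite exprn_gt0. Qed.

Lemma sum_cutw_out j j' x : (j <= j' <= n)%N ->
  \sum_(y in hball j' x :\: hball j x) cutw R x y = (N ^+ j)^-1 - (N ^+ j')^-1.
Proof.
move=> jj'; rewrite (sum_shells L2 d1 x (fun l => N / N ^+ (2 * l)) jj').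
case/andP: jj' => jj' _.
rewrite -opprB -(telescope_sumr (fun l => (N ^+ l)^-1) jj') -sumrN.
apply: eq_bigr => l _; rewrite mulnC exprM expr2 exprS.
by field; rewrite !gt_eqF.
Qed.

(* Every point outside the small ball is on one side of the cut, hence is cut off
   from at least [#|T :&: hball j x|] points of the small ball. *)
Lemma split_cut_half j j' x T : (j <= j' <= n)%N -> T \subset hball j' x ->
  T :&: hball j x != set0 -> (#|T :&: hball j x| <= #|hball j x :\: T|)%N ->
  1 - N ^+ j / N ^+ j' <= \sum_(u in T) \sum_(v in hball j' x :\: T) cutw R u v.
Proof.
move=> jj' TA' T0 Thalf; set A := hball j x in T0 Thalf *; set A' := hball j' x in TA' *.
have [jle j'n] := andP jj'; have jn := leq_trans jle j'n.
have AA' : A \subset A' by rewrite hball_subset.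
set A0 := T :&: A in T0 Thalf *; set A1 := A :\: T in Thalf *.
have iso := @isoperimetry R d L n L2 d1 j x A0 jn (subsetIr _ _) T0.
have A1E : A :\: A0 = A1 by rewrite /A0 /A1 setDIr setDv setU0.
rewrite -/A A1E in iso.
have wc u v : u \in A -> v \notin A -> cutw R u v = cutw R x v.
  by move=> uA vA; rewrite /cutw (hball_lvl uA vA).
have out := sum_cutw_out x jj'; rewrite -/A -/A' in out.
set a0 := #|A0|%:R in iso.
have a01 : a0 <= #|A1|%:R :> R by rewrite ler_nat.
have a0N : a0 <= N ^+ j by rewrite -(card_hballR R x jn) ler_nat subset_leq_card// subsetIr.
have sA (F : V -> R) : \sum_(v in A' :\: T) F v =
    \sum_(v in A1) F v + \sum_(v in (A' :\: A) :\: T) F v.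
  rewrite (big_setID A)/=; congr (_ + _); apply: eq_bigl => v; rewrite !inE -!in_hball -/A -/A'.
    by case: (boolP (v \in A)) => [/(subsetP AA') ->|]; rewrite ?andbT ?andbF.
  by rewrite andbCA.
have -> : \sum_(u in T) \sum_(v in A' :\: T) cutw R u v =
   \sum_(u in A0) \sum_(v in A1) cutw R u v +
   \sum_(u in A0) \sum_(v in (A' :\: A) :\: T) cutw R u v +
   \sum_(u in T :\: A) \sum_(v in A' :\: T) cutw R u v.
  rewrite (big_setID A)/=; congr (_ + _); rewrite -big_split/=.
  by apply: eq_bigr => u _; rewrite sA.
have b1 : a0 * \sum_(v in (A' :\: A) :\: T) cutw R x v =
    \sum_(u in A0) \sum_(v in (A' :\: A) :\: T) cutw R u v.
  rewrite /a0 -sum1_cardR mulr_suml; apply: eq_bigr => u; rewrite in_setI => /andP[_ uA].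
  by rewrite mul1r; apply: eq_bigr => v; rewrite !in_setD => /and3P[_ vA _]; rewrite wc.
have b2 : a0 * \sum_(u in T :\: A) cutw R x u <=
    \sum_(u in T :\: A) \sum_(v in A' :\: T) cutw R u v.
  rewrite mulr_sumr; apply: ler_sum => u; rewrite in_setD => /andP[uA _].
  apply: (@le_trans _ _ (\sum_(v in A1) cutw R u v)).
    rewrite (eq_bigr (fun=> cutw R x u)); last first.
      by move=> v; rewrite in_setD => /andP[_ vA]; rewrite cutw_sym wc.
    by rewrite sumr_const -[leRHS]mulr_natl ler_wpM2r// cutw_ge0.
  by rewrite sA lerDl sumr_ge0// => v _; exact: cutw_ge0.
have outs : \sum_(v in A' :\: A) cutw R x v =
   \sum_(u in T :\: A) cutw R x u + \sum_(v in (A' :\: A) :\: T) cutw R x v.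
  rewrite (big_setID T)/=; congr (_ + _); apply: eq_bigl => v; rewrite !inE -!in_hball -/A -/A'.
  by case: (boolP (v \in T)) => [/(subsetP TA') ->|]; rewrite ?andbT ?andbF.
have a0ge0 : 0 <= a0 by rewrite ler0n.
have key : a0 * ((N ^+ j)^-1 - (N ^+ j')^-1) <=
   \sum_(u in A0) \sum_(v in (A' :\: A) :\: T) cutw R u v +
   \sum_(u in T :\: A) \sum_(v in A' :\: T) cutw R u v.
  by rewrite -out outs mulrDr addrC -b1 lerD2l.
have : a0 / N ^+ j' <= N ^+ j / N ^+ j' by rewrite ler_wpM2r// invr_ge0 ltW.
rewrite mulrBr in key; lra.
Qed.

(** The cut weight is symmetric in [T] and its complement in the large ball, so [T] may be assumed
    to contain at most half of the small ball. *)
Lemma split_cut j j' x T : (j <= j' <= n)%N -> T \subset hball j' x ->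
  T :&: hball j x != set0 -> hball j x :\: T != set0 ->
  1 - N ^+ j / N ^+ j' <= \sum_(u in T) \sum_(v in hball j' x :\: T) cutw R u v.
Proof.
move=> jj' TA' T0 T1; have [h|/ltnW h] := leqP #|T :&: hball j x| #|hball j x :\: T|.
  exact: split_cut_half.
have jle := hball_subset x (proj1 (andP jj')).
set T' := hball j' x :\: T.
have T'E : hball j' x :\: T' = T by rewrite setDDr setDv set0U (setIidPr TA').
have T'I : T' :&: hball j x = hball j x :\: T.
  by rewrite setIC setIDA (setIidPl jle).
have T'D : hball j x :\: T' = T :&: hball j x.
  by rewrite setDDr (eqP (_ : hball j x :\: hball j' x == set0)) ?setD_eq0// set0U setIC.
have := @split_cut_half j j' x T' jj' (subsetDl _ _).
rewrite T'I T'D T'E => /(_ T1 h) /le_trans; apply.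
rewrite exchange_big/= le_eqVlt; apply/orP; left; apply/eqP.
by apply: eq_bigr => u _; apply: eq_bigr => v _; exact: cutw_sym.
Qed.

Variables (r : nat) (eta : R).
Hypothesis eta01 : 0 < eta < 1.
Notation B k x := (hball (r * k) x).

Definition inner_adj w A : rel V := fun y z => [&& y != z, y \in A, z \in A & open_adj w y z].
Definition light_in (G : {set V}) k x := #|G :&: B k x|%:R < (1 - eta) * N ^+ (r * k).
Definition tied_in (G : {set V}) k x w :=
  [forall y in G :&: B k x, [forall z in G :&: B k x, connect (inner_adj w (B k.+1 x)) y z]].

(* [B k x] is the ball of level [r * k].  A ball of scale [k] is good when its
   core is dense and is connected inside the next larger ball; looking one scale
   ahead is what makes a failure as unlikely as the isolation of the whole ball. *)
Fixpoint core k w : {set V} :=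
  if k is k'.+1 then
    [set x in core k' w | ~~ light_in (core k' w) k' x && tied_in (core k' w) k' x w]
  else [set: V].

Definition light k x w := light_in (core k w) k x.
Definition tied k x w := tied_in (core k w) k x w.
Definition good k x w := ~~ light k x w && tied k x w.

Lemma in_coreS k x w : (x \in core k.+1 w) = (x \in core k w) && good k x w.
Proof. by rewrite inE. Qed.

Lemma light_eq k x y w : y \in B k x -> light k y w = light k x w.
Proof. by move=> yx; rewrite /light /light_in (hball_eq yx). Qed.

Lemma hballS k x y : y \in B k x -> y \in B k.+1 x.
Proof. by apply: subsetP; rewrite hball_subset// leq_mul2l leqnSn orbT. Qed.

Lemma tied_eq k x y w : y \in B k x -> tied k y w = tied k x w.
Proof. by move=> yx; rewrite /tied /tied_in (hball_eq yx) (hball_eq (hballS yx)). Qed.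

Lemma good_eq k x y w : y \in B k x -> good k y w = good k x w.
Proof. by move=> yx; rewrite /good (light_eq _ yx) (tied_eq _ yx). Qed.

Lemma inner_adj_loc A w w' : agree (inside A) w w' -> inner_adj w A =2 inner_adj w' A.
Proof.
move=> ww' y z; rewrite /inner_adj; case: eqVneq => //= yz.
case: (boolP (y \in A)) => //= yA; case: (boolP (z \in A)) => //= zA.
have [e eE] := mk_edge yz; rewrite !(open_adjE _ yz eE) ww'//.
by rewrite (in_inside _ eE) yA.
Qed.

Lemma inner_adj_sym w A : symmetric (inner_adj w A).
Proof. by move=> y z; rewrite /inner_adj eq_sym open_adj_sym; case: (z == y) => //=; rewrite andbCA. Qed.

Lemma connect_inner_sym w A : connect_sym (inner_adj w A).
Proof. exact/sym_connect_sym/inner_adj_sym. Qed.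

Lemma connect_innerS w A A' y z : A \subset A' ->
  connect (inner_adj w A) y z -> connect (inner_adj w A') y z.
Proof.
move=> AA'; apply: connect_sub => u v /and4P[uv uA vA o]; apply: connect1.
by rewrite /inner_adj uv (subsetP AA' u) ?(subsetP AA' v).
Qed.

Lemma tiedP k x w : reflect
  (forall y z, y \in core k w :&: B k x -> z \in core k w :&: B k x ->
     connect (inner_adj w (B k.+1 x)) y z) (tied k x w).
Proof.
apply: (iffP forall_inP) => [h y z yG zG|h y yG].
  by have /forall_inP := h y yG; apply.
by apply/forall_inP => z; exact: h.
Qed.

(** By induction: lightness of a ball of scale [k] is read inside it, and its being tied is read
    inside the surrounding ball of scale [k.+1], which is the ball in which the core of scale [k.+1]
    is examined. *)
Lemma core_loc k x w w' : agree (inside (B k x)) w w' ->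
  core k w :&: B k x = core k w' :&: B k x.
Proof.
elim: k x w w' => [//|k IH] x w w' ww'; apply/setP => y; rewrite !in_setI !in_coreS.
case: (boolP (y \in B k.+1 x)) => yB; rewrite ?andbF// !andbT.
have sub : B k y \subset B k.+1 x by rewrite hball_sub// leq_mul2l leqnSn orbT.
have ww'y : agree (inside (B k y)) w w' by move=> e /(subsetP (insideS sub)); exact: ww'.
have coreE := IH y w w' ww'y.
have -> : (y \in core k w) = (y \in core k w').
  have : (y \in core k w :&: B k y) = (y \in core k w' :&: B k y) by rewrite coreE.
  by rewrite !in_setI hball_refl !andbT.
congr (_ && (_ && _)); first by rewrite /light /light_in coreE.
rewrite /tied /tied_in coreE; apply: eq_forallb_in => u _; apply: eq_forallb_in => v _.
by apply: eq_connect; apply: inner_adj_loc; rewrite (hball_eq yB).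
Qed.

Lemma depends_on_light k x : depends_on (inside (B k x)) (light k x).
Proof. by move=> w w' /core_loc; rewrite /light /light_in => ->. Qed.

Lemma depends_on_good k x : depends_on (inside (B k.+1 x)) (good k x).
Proof.
move=> w w' ww'; have sub : B k x \subset B k.+1 x.
  by rewrite hball_subset// leq_mul2l leqnSn orbT.
have coreE : core k w :&: B k x = core k w' :&: B k x.
  by apply: core_loc => e /(subsetP (insideS sub)); exact: ww'.
rewrite /good /light /tied /light_in /tied_in coreE; congr (_ && _).
apply: eq_forallb_in => u _; apply: eq_forallb_in => v _.
by apply: eq_connect; apply: inner_adj_loc.
Qed.

Lemma depends_on_core k : depends_on (low d L n (r * k)) (core k).
Proof.
move=> w w' ww'; apply/setP => x.
have : core k w :&: B k x = core k w' :&: B k x.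
  by apply: core_loc => e /(subsetP (inside_low _ _)); exact: ww'.
by move/setP/(_ x); rewrite !in_setI hball_refl !andbT.
Qed.

Lemma le_low j j' : (j <= j')%N -> low d L n j \subset low d L n j'.
Proof.
move=> jj'; apply/subsetP => e; rewrite !inE => /existsP[x ex]; apply/existsP; exists x.
by rewrite (subset_trans ex)// hball_subset.
Qed.

End Supercritical.

(** * One renormalisation step: failures of connectivity *)

Section Recursion.
Variables (R : realType) (d L n : nat) (J : nat -> R).
Hypothesis L2 : (2 <= L)%N.
Hypothesis d1 : (1 <= d)%N.
Hypothesis J_ge0 : forall k, (1 <= k)%N -> 0 <= J (L ^ k)%N.
Notation V := (vert d L n).
Notation E := (edge d L n).
Notation C := (config d L n).
Notation N := ((L ^ d)%N%:R : R).
Notation Prob := (@Pr R d L n J).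
Notation Exp := (@Ex R d L n J).
Notation rt := (@rate R d L n J).
Implicit Types (x y z : V) (e : E) (w : C) (A T : {set V}).
Variables (r : nat) (eta : R).
Hypothesis eta01 : 0 < eta < 1.
Notation B k x := (hball (r * k) x).
Notation Core := (core r eta).
Notation Light := (light r eta).
Notation Tied := (tied r eta).
Notation Good := (good r eta).

Let N_ge2 : 2 <= N. Proof. exact: N_ge2. Qed.
Let N_gt0 : 0 < N. Proof. exact: lt_le_trans N_ge2. Qed.
Let N_ge1 : 1 <= N. Proof. by rewrite (le_trans _ N_ge2)// ler1n. Qed.
Let NX_gt0 j : 0 < N ^+ j. Proof. by rewrite exprn_gt0. Qed.
Let eta1_ge0 : 0 <= 1 - eta. Proof. by case/andP: eta01 => ? ?; rewrite subr_ge0 ltW. Qed.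

(** As [f] is constant on each ball of scale [k] and the core fills a proportion at least [1 - eta]
    of it, the inequality holds ball by ball. It transfers the weight of a full cut to the cut
    between cores. *)
Lemma heavy_sum k w A (f : V -> R) : (r * k <= n)%N -> saturated (r * k) A ->
  (forall y, y \in A -> ~~ Light k y w) ->
  (forall y, y \in A -> 0 <= f y) ->
  (forall y z, y \in A -> z \in B k y -> f z = f y) ->
  (1 - eta) * \sum_(y in A) f y <= \sum_(y in Core k w :&: A) f y.
Proof.
move=> kn sA heavy f0 fc.
rewrite [leRHS](eq_bigl (fun y => (y \in A) && (y \in Core k w))); last first.
  by move=> y; rewrite inE andbC.
rewrite [leRHS]big_mkcondr/=.
rewrite [leRHS](eq_bigr (fun y => f y * (y \in Core k w)%:R)); last first.
  by move=> y _; case: (_ \in _); rewrite ?mulr1 ?mulr0.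
rewrite (hball_avg (fun y => (y \in Core k w)%:R) kn sA fc) mulr_sumr.
apply: ler_sum => y yA; rewrite mulrC ler_wpM2l ?f0//.
rewrite ler_pdivlMr//; have := heavy y yA; rewrite /light /light_in -leNgt => /le_trans; apply.
rewrite -sum1_cardR (eq_bigl (fun z => (z \in B k y) && (z \in Core k w))); last first.
  by move=> z; rewrite inE andbC.
rewrite big_mkcondr/= le_eqVlt; apply/orP; left; apply/eqP.
by apply: eq_bigr => z _; case: (_ \in _).
Qed.

Variables (k : nat) (x : V) (lc b : R).
Notation A := (B k.+1 x).
Notation A' := (B k.+2 x).
Notation M := (N ^+ r).
Hypothesis kn : (r * k.+2 <= n)%N.
Hypothesis M3 : 3 <= M.
Hypothesis lc_ge0 : 0 <= lc.
Hypothesis J_lb : forall l, (r * k < l)%N -> lc * (N / N ^+ (2 * l)) <= J (L ^ l)%N.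
Hypothesis bad_le : forall y, Prob (fun w => ~~ Good k y w) <= b.

Let k0n : (r * k <= n)%N. Proof. by rewrite (leq_trans _ kn)// leq_mul2l (leq_trans (leqnSn k)) ?orbT. Qed.
Let k1n : (r * k.+1 <= n)%N. Proof. by rewrite (leq_trans _ kn)// leq_mul2l leqnSn orbT. Qed.
Let k12 : (r * k.+1 <= r * k.+2)%N. Proof. by rewrite leq_mul2l leqnSn orbT. Qed.
Let k02 : (r * k <= r * k.+2)%N. Proof. by rewrite (leq_trans _ k12)// leq_mul2l leqnSn orbT. Qed.
Let k01 : (r * k <= r * k.+1)%N. Proof. by rewrite leq_mul2l leqnSn orbT. Qed.

Definition units : {set {set V}} := [set B k y | y in A'].

Lemma units_partition : partition units A'.
Proof.
have -> : units = equivalence_partition (fun y z => z \in B k y) A'.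
  apply/setP => u; apply/imsetP/imsetP => -[y yA ->]; exists y => //.
    apply/setP => z; rewrite inE andb_idl//.
    exact: (subsetP (hball_sub k02 yA)).
  apply/setP => z; rewrite inE andb_idl//.
  exact: (subsetP (hball_sub k02 yA)).
apply: equivalence_partitionP => y z t _ _ _; split; first exact: hball_refl.
by move=> /hball_eq ->.
Qed.

Lemma unitP u : u \in units -> exists2 y, y \in A' & u = B k y.
Proof. by move=> /imsetP[y yA ->]; exists y. Qed.

Lemma unit_in y : y \in A' -> B k y \in units.
Proof. by move=> yA; apply/imsetP; exists y. Qed.

Lemma card_units : #|units|%:R = M ^+ 2 :> R.
Proof.
have uni u : u \in units -> #|u| = ((L ^ d) ^ (r * k))%N.
  by move=> /unitP[y _ ->]; rewrite card_hball.
have h : N ^+ (r * k.+2) = #|units|%:R * N ^+ (r * k).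
  rewrite -(card_hballR R x kn) (card_uniform_partition uni units_partition) natrM.
  by rewrite [X in _ * X]natrX.
have nz : N ^+ (r * k) != 0 by rewrite gt_eqF.
apply: (mulIf nz); rewrite -h (_ : r * k.+2 = r * 2 + r * k)%N; last by rewrite -mulnDr.
by rewrite exprD exprM.
Qed.

Definition rep (u : {set V}) : V := odflt x [pick y in u].

Lemma rep_in y : rep (B k y) \in B k y.
Proof.
rewrite /rep; case: pickP => [//|/(_ y)].
by rewrite /= hball_refl.
Qed.

Lemma cover_sub (Q : {set {set V}}) : Q \subset units -> cover Q \subset A'.
Proof.
move=> QU; apply/bigcupsP => u /(subsetP QU) /unitP[y yA ->].
exact: hball_sub k02 yA.
Qed.

Lemma cover_sat (Q : {set {set V}}) : Q \subset units -> saturated (r * k) (cover Q).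
Proof.
move=> QU y /bigcupP[u uQ yu]; have [z _ uE] := unitP (subsetP QU _ uQ).
have -> : B k y = u by rewrite uE; apply: hball_eq; rewrite -uE.
exact: bigcup_sup.
Qed.

Lemma coverC_sat (Q : {set {set V}}) : Q \subset units -> saturated (r * k) (A' :\: cover Q).
Proof.
move=> QU y; rewrite in_setD => /andP[yQ yA]; apply/subsetP => z zy.
rewrite in_setD (subsetP (hball_sub k02 yA))// andbT.
apply: contra yQ => zQ; apply: (subsetP (cover_sat QU zQ)).
by rewrite hball_sym.
Qed.

(** Cuts are made of whole units, so their number is at most 2 to the power [#|units|], a bound that
    does not grow with the scale. Splitting [A] is what makes [split_cut] applicable. *)
Definition cuts : {set {set {set V}}} :=
  [set Q in powerset units | (cover Q :&: A != set0) && (A :\: cover Q != set0)].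

Definition cut_event (Q : {set {set V}}) w :=
  [forall y in A', ~~ Light k y w] &&
  closed_in (cross (Core k w :&: cover Q) (Core k w :&: (A' :\: cover Q))) w.

Let depends_heavy : depends_on (low d L n (r * k)) (fun w => [forall y in A', ~~ Light k y w]).
Proof.
move=> w w' ww'; apply: eq_forallb_in => y _; congr (~~ _).
exact: (depends_onS (inside_low _ _) (@depends_on_light R d L n r eta k y) ww').
Qed.

(** Cores and lightness of the units are read on edges of level at most [r * k]; edges between
    distinct units are longer, hence fresh. Applying [heavy_sum] on each side of the cut gives the
    factor [(1 - eta) ^+ 2], and [split_cut] gives [1 - 1 / M]. *)
Lemma Pr_cut_event Q : Q \in cuts ->
  Prob (cut_event Q) <= expR (- ((1 - eta) ^+ 2 * (1 - M^-1) * lc)).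
Proof.
rewrite inE powersetE => /and3P[QU Q0 Q1]; set T := cover Q in Q0 Q1 *.
have TA' : T \subset A' := cover_sub QU.
have Tsat := cover_sat QU; have TCsat := coverC_sat QU; rewrite -/T in Tsat TCsat.
have notin u v : u \in T -> v \in A' :\: T -> v \notin B k u.
  move=> uT; rewrite in_setD => /andP[vT _]; apply: contra vT.
  exact: (subsetP (Tsat u uT)).
apply: (@le_trans _ _ (Prob (fun w => [forall y in A', ~~ Light k y w]) *
   expR (- ((1 - eta) ^+ 2 * (1 - M^-1) * lc)))); last first.
  by rewrite ler_piMl ?expR_ge0// Pr_le1.
apply: (@Pr_no_cross_le R d L n J J_ge0 (low d L n (r * k))
   (fun w => Core k w :&: T) (fun w => Core k w :&: (A' :\: T))).
- exact: depends_heavy.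
- by move=> w w' /depends_on_core ->.
- by move=> w w' /depends_on_core ->.
- move=> w; rewrite disjoint_subset; apply/subsetP => y; rewrite in_setI => /andP[_ yT].
  by rewrite inE/= !inE yT/= andbF.
- move=> w; apply: cross_disjoint_low => u v; rewrite !in_setI => /andP[_ uT] /andP[_ vT].
  exact: notin.
move=> w /forall_inP heavy.
have r0 u v : u \in T -> v \in A' :\: T -> 0 <= rt u v.
  move=> uT vT; apply: rate_ge0 => //; apply: contraNneq (notin u v uT vT) => ->.
  exact: hball_refl.
apply: (@le_trans _ _ ((1 - eta) * \sum_(u in Core k w :&: T) \sum_(v in A' :\: T) rt u v)); last first.
  rewrite mulr_sumr; apply: ler_sum => u; rewrite in_setI => /andP[_ uT].
  apply: heavy_sum => //.
  - by move=> y; rewrite in_setD => /andP[_ /heavy].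
  - by move=> y; exact: r0.
  - move=> y z yT zy; rewrite /rate; congr (J (L ^ _)%N).
    exact: level_isosceles (notin u y uT yT) zy.
rewrite expr2 -!mulrA ler_wpM2l//.
apply: (@le_trans _ _ ((1 - eta) * \sum_(u in T) \sum_(v in A' :\: T) rt u v)); last first.
  apply: heavy_sum => //.
  - by move=> y /(subsetP TA') /heavy.
  - by move=> y yT; apply: sumr_ge0 => v; exact: r0.
  - move=> y z yT zy; apply: eq_bigr => v vT; rewrite /rate; congr (J (L ^ _)%N).
    exact: hball_lvl zy (notin y v yT vT).
rewrite ler_wpM2l//.
have := @split_cut R d L n L2 d1 (r * k.+1) (r * k.+2) x T.
rewrite k12 kn => /(_ isT TA' Q0 Q1).
have -> : N ^+ (r * k.+1) / N ^+ (r * k.+2) = M^-1.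
  by rewrite [in X in _ / X]mulnS exprD; field; rewrite !gt_eqF.
move=> cut; apply: (@le_trans _ _ (lc * \sum_(u in T) \sum_(v in A' :\: T) cutw R u v)).
  by rewrite mulrC ler_wpM2l.
rewrite mulr_sumr; apply: ler_sum => u uT; rewrite mulr_sumr; apply: ler_sum => v vT.
rewrite /cutw /rate J_lb//; have := notin u v uT vT; by rewrite in_hball -ltnNge.
Qed.

Definition some_bad w := [exists y in A', ~~ Good k y w].

Definition far_event y z w :=
  (some_bad w && (~~ Light k y w && ~~ Light k z w)) &&
  closed_in (cross (Core k w :&: B k y) (Core k w :&: B k z)) w.

Let loc_good y : depends_on (low d L n (r * k.+1)) (Good k y).
Proof. exact: (depends_onS (inside_low _ _) (@depends_on_good R d L n r eta k y)). Qed.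

Let loc_light y : depends_on (low d L n (r * k.+1)) (Light k y).
Proof.
have h := depends_onS (inside_low _ _) (@depends_on_light R d L n r eta k y).
exact: (depends_onS (@le_low d L n _ _ k01) h).
Qed.

Let loc_core : depends_on (low d L n (r * k.+1)) (Core k).
Proof. exact: (depends_onS (@le_low d L n _ _ k01) (@depends_on_core R d L n r eta k)). Qed.

(** Badness is read on edges of level at most [r * k.+1], and [y], [z] lie in different balls of
    that level, so the edges between their units are fresh and the two probabilities multiply. These
    edges have level at most [r * k.+2] and each core has at least [(1 - eta) * N ^ (r * k)] points,
    whence [N / M ^ 4]. *)
Lemma Pr_far_event y z : y \in A' -> z \in A' -> z \notin B k.+1 y ->
  Prob (far_event y z) <= Prob some_bad * expR (- ((1 - eta) ^+ 2 * (N / M ^+ 4) * lc)).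
Proof.
move=> yA zA far.
have far' u v : u \in B k y -> v \in B k z -> v \notin B k.+1 u.
  move=> uy vz; apply: contra far => vu.
  have uy' : u \in B k.+1 y := hballS uy; have vz' : v \in B k.+1 z := hballS vz.
  by rewrite -(hball_eq uy') -(hball_eq vu) (hball_eq vz') hball_refl.
apply: (@le_trans _ _ (Prob (fun w => some_bad w && (~~ Light k y w && ~~ Light k z w)) *
    expR (- ((1 - eta) ^+ 2 * (N / M ^+ 4) * lc)))); last first.
  by rewrite ler_wpM2r ?expR_ge0// le_Pr// => w /andP[].
apply: (@Pr_no_cross_le R d L n J J_ge0 (low d L n (r * k.+1))
   (fun w => Core k w :&: B k y) (fun w => Core k w :&: B k z)).
- move=> w w' ww'.
  have sb : some_bad w = some_bad w'.
    by apply: eq_existsb => u; have -> := loc_good u ww'.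
  have ly := loc_light y ww'.
  have lz := loc_light z ww'.
  by rewrite sb ly lz.
- by move=> w w' /loc_core ->.
- by move=> w w' /loc_core ->.
- move=> w; rewrite disjoint_subset; apply/subsetP => u; rewrite in_setI => /andP[_ uy].
  rewrite inE/=; apply/negP; rewrite in_setI => /andP[_ uz].
  by have /negP := far' u u uy uz; apply; exact: hball_refl.
- move=> w; apply: cross_disjoint_low => u v; rewrite !in_setI => /andP[_ uy] /andP[_ vz].
  exact: far'.
move=> w /and3P[_ hy hz].
pose rho := lc * (N / N ^+ (2 * (r * k.+2))).
have rho0 : 0 <= rho by rewrite mulr_ge0// divr_ge0 ?exprn_ge0 ?(ltW N_gt0).
apply: (@le_trans _ _ (\sum_(u in Core k w :&: B k y) \sum_(v in Core k w :&: B k z) rho)); last first.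
  apply: ler_sum => u; rewrite in_setI => /andP[_ uy]; apply: ler_sum => v; rewrite in_setI => /andP[_ vz].
  have := far' u v uy vz; rewrite in_hball -ltnNge => lev.
  apply: le_trans (J_lb (leq_ltn_trans k01 lev)); rewrite /rho ler_wpM2l// ler_wpM2l ?(ltW N_gt0)//.
  rewrite lef_pV2 ?posrE// ler_weXn2l// leq_mul2l /=.
  have uA : u \in A' := subsetP (hball_sub k02 yA) _ uy.
  have vA : v \in A' := subsetP (hball_sub k02 zA) _ vz.
  by rewrite -in_hball (hball_eq uA).
rewrite sumr_const -[leRHS]mulr_natl sumr_const -[rho *+ _]mulr_natl.
move: hy hz; rewrite /light /light_in -!leNgt => hy hz.
have -> : (1 - eta) ^+ 2 * (N / M ^+ 4) * lc =
    ((1 - eta) * N ^+ (r * k)) * (((1 - eta) * N ^+ (r * k)) * rho).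
  have -> : rho = lc * (N / (N ^+ (r * k) * N ^+ (r * k) * M ^+ 4)).
    have e : (2 * (r * k.+2) = r * k + r * k + r * 4)%N.
      by rewrite -[k.+2]addn2 mulnDr mul2n -addnn addnACA; congr addn; rewrite -mulnDr.
    by rewrite /rho e !exprD [N ^+ (r * 4)]exprM.
  by field; rewrite !gt_eqF ?exprn_gt0.
have h0 : 0 <= (1 - eta) * N ^+ (r * k) by rewrite mulr_ge0// ltW.
by apply: ler_pM => //; [rewrite mulr_ge0|rewrite ler_wpM2r].
Qed.

Definition far_pairs : {set {set V} * {set V}} :=
  [set p in setX units units | rep p.2 \notin B k.+1 (rep p.1)].

Lemma rep_A' u : u \in units -> rep u \in A'.
Proof. by move=> /unitP[y yA ->]; exact: (subsetP (hball_sub k02 yA)) (rep_in y). Qed.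

(** As [M >= 3], there is room in [A'] for three disjoint balls of scale [k.+1]. The units of [x2]
    and [x3] then fail independently of each other. *)
Lemma far_points : exists x2 x3, [/\ x2 \in A', x3 \in A',
  x2 \notin A, x3 \notin A & x3 \notin B k.+1 x2].
Proof.
have cA : #|A'|%:R = M * #|A|%:R :> R.
  by rewrite !card_hballR// mulnS exprD.
have A0 : 0 < #|A|%:R :> R by rewrite ltr0n; apply/card_gt0P; exists x; exact: hball_refl.
have nsub T : #|T|%:R <= 2 * #|A|%:R :> R -> exists2 y, y \in A' & y \notin T.
  move=> T2; have : ~~ (A' \subset T).
    apply/negP => /subset_leq_card; rewrite -(ler_nat R) cA; have := ler_wpM2r (ltW A0) M3; lra.
  by move=> /subsetPn[y yA yT]; exists y.
have [x2 x2A' x2A] : exists2 y, y \in A' & y \notin A by apply: nsub; lra.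
have [x3 x3A'] : exists2 y, y \in A' & y \notin A :|: B k.+1 x2.
  apply: nsub; have := (leq_card_setU A (B k.+1 x2)).1; rewrite -(ler_nat R) natrD.
  rewrite (_ : #|B k.+1 x2| = #|A|); last by rewrite !card_hball.
  by lra.
rewrite in_setU negb_or => /andP[x3A x32].
by exists x2, x3.
Qed.

(* If all units are good, the component of a point of the core of [A] is a union
   of units, hence yields a closed cut.  If some unit is bad and no two far
   units are separated, any good unit outside [A] connects the core of [A]. *)
Lemma loose_cases x2 x3 w : x2 \in A' -> x3 \in A' -> x2 \notin A -> x3 \notin A ->
  ~~ Tied k.+1 x w ->
  [|| [exists Q in cuts, cut_event Q w],
      [exists p in far_pairs, far_event (rep p.1) (rep p.2) w] |
      ~~ Good k x2 w && ~~ Good k x3 w].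
Proof.
move=> x2A' x3A' x2A x3A loose.
have AA' : A \subset A' by rewrite hball_subset.
have subA' y : y \in A' -> B k.+1 y \subset A' by move=> ?; exact: hball_sub.
have [/existsP[Q QE]|nocut] := boolP [exists Q in cuts, cut_event Q w]; first by [].
have [//|nofar /=] := boolP [exists p in far_pairs, far_event (rep p.1) (rep p.2) w].
have [//|/nandP x23] := boolP (~~ Good k x2 w && ~~ Good k x3 w); exfalso.
(* One of the two distant units is good; it is the relay of the second case. *)
have {x23} [g [gA' gA gg]] : exists g, [/\ g \in A', g \notin A & Good k g w].
  by case: x23 => /negPn ?; [exists x2|exists x3].
move/negP: loose; apply; apply/tiedP => y z yG zG.
apply/negPn/negP => nyz.
have [yc yA] : y \in Core k.+1 w /\ y \in A by move: yG; rewrite in_setI => /andP.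
have [zc zA] : z \in Core k.+1 w /\ z \in A by move: zG; rewrite in_setI => /andP.
have [yk /andP[yl /tiedP yt]] : y \in Core k w /\ Good k y w by apply/andP; rewrite -in_coreS.
have [zk /andP[zl /tiedP zt]] : z \in Core k w /\ Good k z w by apply/andP; rewrite -in_coreS.
have yA' := subsetP AA' _ yA; have zA' := subsetP AA' _ zA.
have [bad|/negPn allgood] := boolP (some_bad w); last first.
  have allgood' u : u \in A' -> Good k u w.
    move=> uA; apply/negPn/negP => ub; move/negPn/negP: allgood; apply.
    by apply/exists_inP; exists u.
  (* The units met by the component of [y] in [A']. As all units are tied, this component contains
     their whole cores. *)
  pose Q := [set u in units | [exists s in Core k w :&: u, connect (inner_adj w A') y s]].
  have QU : Q \subset units by apply/subsetP => u; rewrite inE => /andP[].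
  have inQ u s : u \in A' -> s \in Core k w -> s \in B k u ->
      connect (inner_adj w A') y s -> u \in cover Q.
    move=> uA sc su ys; apply/bigcupP; exists (B k u); last exact: hball_refl.
    rewrite inE unit_in//=; apply/exists_inP; exists s => //; by rewrite in_setI sc.
  have Qin u : u \in Core k w -> u \in cover Q -> connect (inner_adj w A') y u.
    move=> uc /bigcupP[u' u'Q uu']; move: u'Q; rewrite inE => /andP[/unitP[t tA tE]].
    move=> /exists_inP[s]; rewrite in_setI => /andP[sc su'] ys.
    have ut : u \in B k t by rewrite -tE.
    have st : s \in B k t by rewrite -tE.
    have /andP[_ /tiedP tt] := allgood' t tA.
    apply: connect_trans ys _; apply: connect_innerS (subA' t tA) _.
    by apply: tt; rewrite in_setI ?sc ?uc.
  have yQ : y \in cover Q by apply: (inQ y y) => //; rewrite ?hball_refl// connect0.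
  have zQ : z \notin cover Q by apply: contra nyz; exact: Qin.
  move/negP: nocut; apply; apply/exists_inP; exists Q.
    rewrite inE powersetE QU/=; apply/andP; split; apply/set0Pn.
      by exists y; rewrite in_setI yQ.
    by exists z; rewrite in_setD zQ.
  apply/andP; split; first by apply/forall_inP => u /allgood' /andP[].
  have dis : [disjoint Core k w :&: cover Q & Core k w :&: (A' :\: cover Q)].
    rewrite disjoint_subset; apply/subsetP => u; rewrite in_setI => /andP[_ uQ].
    by rewrite inE/= !inE uQ/= andbF.
  apply/closed_crossP => // u v; rewrite in_setI => /andP[uc uQ].
  rewrite in_setI in_setD => /and3P[vc vQ vA']; apply: contra vQ => uv.
  have [<- //|uv'] := eqVneq u v.
  have uA' : u \in A' := subsetP (cover_sub QU) _ uQ.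
  apply: (inQ v v) => //; first exact: hball_refl.
  apply: connect_trans (Qin u uc uQ) (connect1 _).
  by rewrite /inner_adj uA' vA' uv uv'.
have adj u v : u \in A' -> v \in A' -> v \notin B k.+1 u -> ~~ Light k u w -> ~~ Light k v w ->
    exists s t, [/\ s \in Core k w :&: B k u, t \in Core k w :&: B k v & open_adj w s t].
  move=> uA vA uv ul vl; set p := (B k u, B k v).
  have p1 : rep p.1 \in B k u by exact: rep_in.
  have p2 : rep p.2 \in B k v by exact: rep_in.
  have uv' u' v' : u' \in B k u -> v' \in B k v -> v' \notin B k.+1 u'.
    move=> uu vv; apply: contra uv => vu.
    by rewrite -(hball_eq (hballS uu)) -(hball_eq vu) (hball_eq (hballS vv)) hball_refl.
  have pfar : p \in far_pairs by rewrite inE in_setX !unit_in//= uv'.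
  have : ~~ far_event (rep p.1) (rep p.2) w.
    by apply: contra nofar => fe; apply/exists_inP; exists p.
  rewrite /far_event bad (light_eq _ _ p1) (light_eq _ _ p2) ul vl/=.
  rewrite (hball_eq p1) (hball_eq p2) negb_forall_in => /exists_inP[e].
  move=> /crossP[s [t [sc tc eE]]] /negbNE we; exists s, t; split=> //.
  apply/open_adjP; exists e; by rewrite eE !inE !eqxx orbT.
have /andP[gl /tiedP gt] := gg.
(* An open edge joins the core of the unit of [u] to that of the relay, and the tie of the unit of
   [u] links [u] to the end of this edge without leaving [A']. *)
have conn u : u \in Core k w -> u \in A -> ~~ Light k u w ->
    (forall u1 u2, u1 \in Core k w :&: B k u -> u2 \in Core k w :&: B k u ->
     connect (inner_adj w (B k.+1 u)) u1 u2) ->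
    exists2 t, t \in Core k w :&: B k g & connect (inner_adj w A') u t.
  move=> uc uA ul ut; have uA' := subsetP AA' _ uA.
  have gu : g \notin B k.+1 u by rewrite (hball_eq uA).
  have [s [t [sc tc st]]] := adj u g uA' gA' gu ul gl; exists t => //.
  have sB : s \in B k u by move: sc; rewrite in_setI => /andP[].
  have tB : t \in B k g by move: tc; rewrite in_setI => /andP[].
  apply: (@connect_trans _ _ s).
    apply: connect_innerS (subA' u uA') _; apply: ut => //.
    by rewrite in_setI uc hball_refl.
  apply: connect1; rewrite /inner_adj st andbT.
  rewrite (subsetP (hball_sub k02 uA') _ sB) (subsetP (hball_sub k02 gA') _ tB) !andbT.
  apply: contraNneq gu => stE; rewrite -stE in tB.
  by rewrite -(hball_eq (hballS sB)) (hball_eq (hballS tB)) hball_refl.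
have [t1 t1g yt1] := conn y yk yA yl yt.
have [t2 t2g zt2] := conn z zk zA zl zt.
move/negP: nyz; apply; apply: connect_trans yt1 _.
apply: (@connect_trans _ _ t2).
  by apply: connect_innerS (subA' g gA') _; exact: gt.
by rewrite connect_inner_sym.
Qed.

(** One term for each case of [loose_cases]: a union bound over cuts; a bad unit among [M ^ 2],
    times a failed connection for at most [M ^ 4] pairs; two independent bad units. The first term
    fixes the order of the failure probability, and the other two are [b] times quantities that can
    be made small. *)
Lemma Pr_loose : Prob (fun w => ~~ Tied k.+1 x w) <=
  2 ^+ #|units| * expR (- ((1 - eta) ^+ 2 * (1 - M^-1) * lc)) +
  M ^+ 2 * b * (M ^+ 4 * expR (- ((1 - eta) ^+ 2 * (N / M ^+ 4) * lc))) + b ^+ 2.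
Proof.
have [x2 [x3 [x2A' x3A' x2A x3A x23]]] := far_points.
have b0 : 0 <= b by apply: le_trans (bad_le x); exact: Pr_ge0.
apply: (@le_trans _ _ (Prob (fun w => [|| [exists Q in cuts, cut_event Q w],
      [exists p in far_pairs, far_event (rep p.1) (rep p.2) w] |
      ~~ Good k x2 w && ~~ Good k x3 w]))).
  by apply: (le_Pr J_ge0) => w; exact: loose_cases.
apply: le_trans (PrU J_ge0 _ _) _; rewrite -addrA; apply: lerD.
  apply: le_trans (Pr_exists J_ge0 _ _) _.
  apply: (@le_trans _ _ (\sum_(Q in cuts) expR (- ((1 - eta) ^+ 2 * (1 - M^-1) * lc)))).
    by apply: ler_sum => Q; exact: Pr_cut_event.
  rewrite sumr_const -[leLHS]mulr_natl ler_wpM2r ?expR_ge0// -natrX ler_nat -card_powerset.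
  by rewrite subset_leq_card//; apply/subsetP => Q; rewrite inE => /andP[].
apply: le_trans (PrU J_ge0 _ _) _; apply: lerD; last first.
  rewrite /Pr; under eq_Ex do rewrite -mulnb natrM.
  rewrite (@Ex_indep _ _ _ _ J (inside (B k.+1 x2)) (inside (B k.+1 x3)))//.
  - by rewrite expr2 ler_pM ?Pr_ge0//; exact: bad_le.
  - by move=> w w' /depends_on_good ->.
  - by move=> w w' /depends_on_good ->.
  - exact/inside_disjoint/hball_disjoint.
have someb : Prob some_bad <= M ^+ 2 * b.
  apply: (@le_trans _ _ (Prob (fun w => [exists u in units, ~~ Good k (rep u) w]))).
    apply: (le_Pr J_ge0) => w /exists_inP[y yA yb]; apply/exists_inP; exists (B k y); first exact: unit_in.
    by rewrite (good_eq _ _ (rep_in y)).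
  apply: le_trans (Pr_exists J_ge0 _ _) _.
  apply: (@le_trans _ _ (\sum_(u in units) b)); first by apply: ler_sum => u _; exact: bad_le.
  by rewrite sumr_const -[leLHS]mulr_natl card_units.
apply: le_trans (Pr_exists J_ge0 _ _) _.
set e2 := expR _.
apply: (@le_trans _ _ (\sum_(p in far_pairs) (M ^+ 2 * b * e2))).
  apply: ler_sum => -[u v]; rewrite inE in_setX /= => /andP[/andP[uU vU] far].
  apply: le_trans (Pr_far_event (rep_A' uU) (rep_A' vU) far) _.
  by rewrite ler_wpM2r ?expR_ge0.
rewrite sumr_const -[leLHS]mulr_natl.
have -> : M ^+ 2 * b * (M ^+ 4 * e2) = M ^+ 4 * (M ^+ 2 * b * e2) by ring.
rewrite ler_wpM2r ?mulr_ge0 ?expR_ge0 ?exprn_ge0 ?(ltW N_gt0)//.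
apply: (@le_trans _ _ #|setX units units|%:R).
  by rewrite ler_nat subset_leq_card//; apply/subsetP => p; rewrite inE => /andP[].
by rewrite cardsX natrM card_units -exprD.
Qed.

End Recursion.

(** * One renormalisation step: density of the cores *)

Section Loss.
Variables (R : realType) (d L n : nat) (J : nat -> R).
Hypothesis L2 : (2 <= L)%N.
Hypothesis d1 : (1 <= d)%N.
Hypothesis J_ge0 : forall k, (1 <= k)%N -> 0 <= J (L ^ k)%N.
Notation V := (vert d L n).
Notation E := (edge d L n).
Notation C := (config d L n).
Notation N := ((L ^ d)%N%:R : R).
Notation Prob := (@Pr R d L n J).
Notation Exp := (@Ex R d L n J).
Implicit Types (x y z : V) (e : E) (w : C) (T : {set V}).
Variables (r : nat) (eta : R).
Hypothesis eta01 : 0 < eta < 1.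
Notation B k x := (hball (r * k) x).
Notation Core := (core r eta).
Notation Light := (light r eta).
Notation Tied := (tied r eta).
Notation Good := (good r eta).

Let N_ge2 : 2 <= N. Proof. exact: N_ge2. Qed.
Let N_gt0 : 0 < N. Proof. exact: lt_le_trans N_ge2. Qed.
Let NX_gt0 j : 0 < N ^+ j. Proof. by rewrite exprn_gt0. Qed.

(** A light ball counts as entirely lost, since the next core discards it. The average loss of the
    units then differs from the fraction missing in the next core only through loose units. *)
Definition loss k y w : R :=
  if Light k y w then 1 else 1 - #|Core k w :&: B k y|%:R / N ^+ (r * k).

Definition var (f : C -> R) : R := Exp (fun w => (f w - Exp f) ^+ 2).

Lemma loss_itv k y w : (r * k <= n)%N -> 0 <= loss k y w <= 1.
Proof.
move=> kn; rewrite /loss; case: ifP => _; first by rewrite ler01 lexx.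
rewrite subr_ge0 ler_pdivrMr// mul1r lerBlDr lerDl divr_ge0 ?exprn_ge0 ?ler0n ?(ltW N_gt0)//.
by rewrite -(card_hballR R y kn) ler_nat subset_leq_card// subsetIr.
Qed.

Lemma depends_on_loss k y : depends_on (inside (B k y)) (loss k y).
Proof.
move=> w w' ww'; rewrite /loss (@depends_on_light R d L n r eta k y w w' ww').
by rewrite (@core_loc R d L n r eta k y w w' ww').
Qed.

Lemma var_le (f : C -> R) c : var f <= Exp (fun w => (f w - c) ^+ 2).
Proof.
have -> : Exp (fun w => (f w - c) ^+ 2) = var f + (Exp f - c) ^+ 2.
  transitivity (Exp (fun w => (f w - Exp f) ^+ 2 + 2 * (Exp f - c) * (f w - Exp f) + (Exp f - c) ^+ 2)).
    by apply: eq_Ex => w; ring.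
  by rewrite 2!ExD ExZ ExB !Ex_cst subrr mulr0 addr0.
by rewrite lerDl sqr_ge0.
Qed.

Variables (k : nat) (x : V) (q m v : R).
Notation A := (B k.+1 x).
Notation M := (N ^+ r).
Hypothesis kn : (r * k.+1 <= n)%N.
Hypothesis tied_q : forall y, Prob (fun w => ~~ Tied k y w) <= q.
Hypothesis loss_m : forall y, Exp (loss k y) <= m.
Hypothesis m_eta : m <= eta / 2.
Hypothesis loss_v : forall y, var (loss k y) <= v.

Let k01 : (r * k <= r * k.+1)%N. Proof. by rewrite leq_mul2l leqnSn orbT. Qed.
Let k0n : (r * k <= n)%N. Proof. exact: leq_trans kn. Qed.
Notation NA := (N ^+ (r * k.+1)).

Let avg_loss w := (\sum_(y in A) loss k y w) / NA.
Let avg_loose w := (\sum_(y in A) (~~ Tied k y w)%:R) / NA.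
Let gap w := 1 - #|Core k.+1 w :&: A|%:R / NA.

Let sum_out w : gap w = (\sum_(y in A) (y \notin Core k.+1 w)%:R) / NA.
Proof.
rewrite /gap; apply: (mulIf (lt0r_neq0 (NX_gt0 (r * k.+1)))).
rewrite mulrBl !divfK ?gt_eqF// mul1r -(card_hballR R x kn) -!sum1_cardR.
rewrite [X in _ - X](eq_bigl (fun y => (y \in A) && (y \in Core k.+1 w))); last first.
  by move=> y; rewrite inE andbC.
rewrite [X in _ - X]big_mkcondr -sumrB; apply: eq_bigr => y _.
by case: (y \in Core k.+1 w); rewrite ?subrr ?subr0.
Qed.

Let sum_loss w : \sum_(y in A) loss k y w =
  \sum_(y in A) ((~~ Light k y w)%:R * (y \notin Core k w)%:R + (Light k y w)%:R).
Proof.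
rewrite big_split/= (hball_avg (fun y => (y \notin Core k w)%:R) k0n).
- rewrite -big_split; apply: eq_bigr => y yA /=; rewrite /loss.
  case: (Light k y w); rewrite ?mul0r ?mul1r ?add0r// addr0.
  apply: (mulIf (lt0r_neq0 (NX_gt0 (r * k)))).
  rewrite mulrBl !divfK ?gt_eqF// mul1r -(card_hballR R y k0n) -!sum1_cardR.
  rewrite [X in _ - X](eq_bigl (fun z => (z \in B k y) && (z \in Core k w))); last first.
    by move=> z; rewrite inE andbC.
  rewrite [X in _ - X]big_mkcondr -sumrB; apply: eq_bigr => z _.
  by case: (z \in Core k w); rewrite ?subrr ?subr0.
- exact: hball_saturated.
- by move=> y z _ zy; rewrite (light_eq _ _ zy).
Qed.

(** A point outside the next core was already outside the current one, or lies in a light ball, or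
    lies in a loose ball; the first two possibilities are counted by [avg_loss]. *)
Lemma gap_le w : gap w <= avg_loss w + avg_loose w.
Proof.
rewrite sum_out /avg_loss /avg_loose -mulrDl ler_wpM2r ?invr_ge0 ?(ltW (NX_gt0 _))//.
rewrite sum_loss -big_split; apply: ler_sum => y _ /=; rewrite in_coreS /good.
by case: (y \in Core k w); case: (Light k y w); case: (Tied k y w);
  rewrite /= ?mul0r ?mul1r ?mulr0 ?addr0 ?add0r ?lerDl ?ler01.
Qed.

Lemma gap_ge w : avg_loss w <= gap w.
Proof.
rewrite sum_out /avg_loss ler_wpM2r ?invr_ge0 ?(ltW (NX_gt0 _))//.
rewrite sum_loss; apply: ler_sum => y _ /=; rewrite in_coreS /good.
by case: (y \in Core k w); case: (Light k y w); case: (Tied k y w);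
  rewrite /= ?mul0r ?mul1r ?mulr0 ?addr0 ?add0r ?lerDl ?ler01.
Qed.

Lemma avg_const (c : R) (f : V -> R) : (forall y, f y <= c) -> (\sum_(y in A) f y) / NA <= c.
Proof.
move=> fc; rewrite ler_pdivrMr//; apply: (@le_trans _ _ (\sum_(y in A) c)).
  by apply: ler_sum => y _; exact: fc.
by rewrite sumr_const -[leLHS]mulr_natr card_hballR.
Qed.

Lemma Ex_avg_loose : Exp avg_loose <= q.
Proof. by rewrite /avg_loose ExZr Ex_sum; apply: avg_const => y; exact: tied_q. Qed.

Lemma Ex_avg_loss : Exp avg_loss <= m.
Proof. by rewrite /avg_loss ExZr Ex_sum; apply: avg_const. Qed.

(* Losses in distinct units are independent: averaging divides the variance by the
   number of units in [A]. *)
Lemma var_avg_loss : var avg_loss <= v / M.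
Proof.
pose f y w := loss k y w - Exp (loss k y).
have -> : var avg_loss = (\sum_(y in A) \sum_(z in A) Exp (fun w => f y w * f z w)) / NA ^+ 2.
  rewrite /var (_ : Exp (fun w => _) =
    Exp (fun w => (\sum_(y in A) \sum_(z in A) f y w * f z w) / NA ^+ 2)).
    by rewrite ExZr Ex_sum; congr (_ / _); apply: eq_bigr => y _; rewrite Ex_sum.
  apply: eq_Ex => w; rewrite {2}/avg_loss ExZr Ex_sum /avg_loss -mulrBl -sumrB.
  rewrite exprMn exprVn; congr (_ / _); rewrite expr2 mulr_suml.
  by apply: eq_bigr => y _; rewrite mulr_sumr.
rewrite ler_pdivrMr ?exprn_gt0//.
apply: (@le_trans _ _ (\sum_(y in A) v * N ^+ (r * k))); last first.
  rewrite sumr_const -[leLHS]mulr_natl card_hballR// expr2.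
  rewrite [in X in _ <= _ / X * _](_ : M = NA / N ^+ (r * k)).
    by rewrite le_eqVlt; apply/orP; left; apply/eqP; field; rewrite !gt_eqF.
  by rewrite mulnS exprD mulfK// gt_eqF.
apply: ler_sum => y yA; rewrite (big_setID (B k y))/=.
have BA : B k y \subset A by rewrite hball_sub.
rewrite (setIidPr BA) [X in _ + X]big1 ?addr0.
  rewrite mulrC -(card_hballR R y k0n) -sum1_cardR mulr_suml; apply: ler_sum => z _; rewrite mul1r.
  apply: (@le_trans _ _ (Exp (fun w => 2^-1 * (f y w ^+ 2 + f z w ^+ 2)))).
    by apply: (le_Ex J_ge0) => w; have := sqr_ge0 (f y w - f z w); move: (f y w) (f z w) => a c; lra.
  by rewrite ExZ ExD; have := loss_v y; have := loss_v z; rewrite /var -/(f y _) -/(f z _); lra.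
move=> z; rewrite in_setD => /andP[zy _].
rewrite (Ex_cov erefl erefl) (@Ex_indep _ _ _ _ _ (inside (B k y)) (inside (B k z)))//.
- by rewrite subrr.
- exact: depends_on_loss.
- exact: depends_on_loss.
- exact/inside_disjoint/hball_disjoint.
Qed.

Let eta0 : 0 < eta. Proof. by case/andP: eta01. Qed.

(** Lightness means a gap above [eta]. The mean of [avg_loss] being at most [eta / 2], either its
    fluctuation or the loose fraction exceeds [eta / 4]. Chebyshev's inequality with variance
    [v / M] handles the former, Markov's inequality the latter. *)
Lemma Pr_light_next :
  Prob (Light k.+1 x) <= 16 / (M * eta ^+ 2) * v + 4 / eta * q.
Proof.
pose P1 w := eta / 4 < avg_loss w - Exp avg_loss.
pose P2 w := eta / 4 < avg_loose w.
apply: (@le_trans _ _ (Prob (fun w => P1 w || P2 w))).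
  apply: (le_Pr J_ge0) => w; rewrite /light /light_in => li.
  have gap_eta : eta < gap w.
    by rewrite /gap ltrBrDr -ltrBrDl ltr_pdivrMr.
  apply/orP; rewrite /P1 /P2; have := gap_le w; have := Ex_avg_loss; have := m_eta.
  by case: ltP => [?|h1]; [left|case: ltP => [?|h2]; [right|lra]].
apply: le_trans (PrU J_ge0 _ _) _; apply: lerD.
  apply: (@le_trans _ _ (var avg_loss / (eta / 4) ^+ 2)).
    apply: markov_ineq => //; first by rewrite exprn_gt0// divr_gt0.
      by move=> w; exact: sqr_ge0.
    move=> w h; have e4 : 0 < eta / 4 by rewrite divr_gt0.
    by rewrite ler_sqr ?nnegrE ?(ltW e4) ?(ltW (lt_trans e4 h)) ?(ltW h).
  rewrite (_ : 16 / (M * eta ^+ 2) * v = v / M / (eta / 4) ^+ 2).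
    by rewrite ler_wpM2r ?invr_ge0 ?sqr_ge0//; exact: var_avg_loss.
  by field; rewrite !gt_eqF.
apply: (@le_trans _ _ (Exp avg_loose / (eta / 4))).
  apply: markov_ineq => //; first by rewrite divr_gt0.
    move=> w; rewrite /avg_loose divr_ge0 ?(ltW (NX_gt0 _))//.
    by apply: sumr_ge0 => y _; rewrite ler0n.
  by move=> w /ltW.
rewrite (_ : 4 / eta * q = q / (eta / 4)); last by field; rewrite gt_eqF.
by rewrite ler_wpM2r ?invr_ge0 ?divr_ge0 ?(ltW eta0)// Ex_avg_loose.
Qed.

Variable p : R.
Hypothesis light_p : Prob (Light k.+1 x) <= p.

Let loss_next_le w : loss k.+1 x w <= avg_loss w + avg_loose w + (Light k.+1 x w)%:R.
Proof.
have l0 : 0 <= avg_loss w.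
  by rewrite divr_ge0 ?(ltW (NX_gt0 _))// sumr_ge0// => y _; case/andP: (loss_itv y w k0n).
have l1 : 0 <= avg_loose w.
  by rewrite divr_ge0 ?(ltW (NX_gt0 _))// sumr_ge0// => y _; rewrite ler0n.
rewrite /loss; case: ifP => _; first by rewrite lerDr addr_ge0.
by rewrite addr0; exact: gap_le.
Qed.

Let loss_next_ge w : avg_loss w <= loss k.+1 x w.
Proof.
rewrite /loss; case: ifP => _; last exact: gap_ge.
by apply: avg_const => y; case/andP: (loss_itv y w k0n).
Qed.

Lemma Ex_loss_next : Exp (loss k.+1 x) <= m + q + p.
Proof.
apply: le_trans (le_Ex J_ge0 loss_next_le) _.
by rewrite 2!ExD !lerD ?Ex_avg_loss ?Ex_avg_loose.
Qed.

(** The new loss exceeds [avg_loss] by an amount between 0 and 1. The square of this excess is thus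
    at most the excess itself, which is bounded by the loose fraction plus the indicator of
    lightness. *)
Lemma var_loss_next : var (loss k.+1 x) <= 2 / M * v + 2 * (q + p).
Proof.
apply: le_trans (var_le _ (Exp avg_loss)) _.
apply: (@le_trans _ _ (Exp (fun w => 2 * (avg_loss w - Exp avg_loss) ^+ 2 +
   2 * (avg_loose w + (Light k.+1 x w)%:R)))).
  apply: (le_Ex J_ge0) => w.
  have := loss_next_le w; rewrite -addrA; have := loss_next_ge w; have /andP[_] := loss_itv x w kn.
  have : 0 <= avg_loss w.
    by rewrite divr_ge0 ?(ltW (NX_gt0 _))// sumr_ge0// => y _; case/andP: (loss_itv y w k0n).
  move: (avg_loss w) (loss k.+1 x w) (avg_loose w + _) (Exp avg_loss) => a l Y c a0 l1 al lY.
  have h : (l - a) ^+ 2 <= Y by nra.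
  by have := sqr_ge0 ((a - c) - (l - a)); nra.
rewrite ExD !ExZ ExD; apply: lerD.
  by rewrite (_ : 2 / M * v = 2 * (v / M)); [rewrite ler_wpM2l ?var_avg_loss|rewrite mulrAC mulrA].
by rewrite ler_wpM2l// lerD ?Ex_avg_loose.
Qed.

End Loss.

(** * Induction over the scales *)

Section SupercriticalInduction.
Variables (R : realType) (d L n : nat) (J : nat -> R).
Hypothesis L2 : (2 <= L)%N.
Hypothesis d1 : (1 <= d)%N.
Hypothesis J_ge0 : forall k, (1 <= k)%N -> 0 <= J (L ^ k)%N.
Notation V := (vert d L n).
Notation C := (config d L n).
Notation N := ((L ^ d)%N%:R : R).
Notation Prob := (@Pr R d L n J).
Notation Exp := (@Ex R d L n J).
Implicit Types (x y z : V) (w : C).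
Variables (r : nat) (eta : R).
Hypothesis eta01 : 0 < eta < 1.
Notation M := (N ^+ r).
Hypothesis M3 : 3 <= M.
Notation B k x := (hball (r * k) x).
Notation Core := (core r eta).
Notation Light := (light r eta).
Notation Tied := (tied r eta).
Notation Good := (good r eta).
Notation Loss := (@loss R d L n r eta).
Notation Var := (@var R d L n J).

Variables (lc g : nat -> R) (C0 Q P W h tau G : R).
Hypothesis lc_ge0 : forall k, 0 <= lc k.
Hypothesis J_lb : forall k l, (r * k < l)%N -> lc k * (N / N ^+ (2 * l)) <= J (L ^ l)%N.
Hypothesis g_ge0 : forall k, 0 <= g k.
Hypothesis g_next : forall k, g k <= C0 * g k.+1.
Hypothesis g_mono : forall k, g k.+1 <= g k.
Hypothesis g_tau : forall k, g k <= tau.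
Hypothesis g_sum : forall k, \sum_(i < k) g i <= G.
Hypothesis lc_g : forall k, expR (- ((1 - eta) ^+ 2 * (1 - M^-1) * lc k)) <= g k.
Hypothesis lc_h : forall k, expR (- ((1 - eta) ^+ 2 * (N / M ^+ 4) * lc k)) <= h.
Hypotheses (Q0 : 0 <= Q) (P0 : 0 <= P) (W0 : 0 <= W) (C00 : 0 <= C0).
Notation K1 := (2 ^+ (((L ^ d) ^ r) ^ 2)%N : R).
Hypothesis HQ : C0 * (K1 + M ^+ 6 * h * (P + Q) + (P + Q) ^+ 2 * tau) <= Q.
Hypothesis HP : C0 * (16 / (M * eta ^+ 2) * W + 4 / eta * Q) <= P.
Hypothesis HW : C0 * (2 / M * W + 2 * Q) + 2 * P <= W.
Hypothesis HG : (P + Q) * G <= eta / 2.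

Let N_gt0 : 0 < N. Proof. exact: lt_le_trans (N_ge2 R L2 d1). Qed.
Let eta0 : 0 < eta. Proof. by case/andP: eta01. Qed.

Let step k X Y : 0 <= X -> C0 * X <= Y -> X * g k <= Y * g k.+1.
Proof.
move=> X0 XY; apply: (@le_trans _ _ (X * (C0 * g k.+1))); first by rewrite ler_wpM2l.
by rewrite mulrA ler_wpM2r// mulrC.
Qed.

(** The bounds on looseness, lightness and variance are propagated together, as constant multiples
    of one profile [g]. The hypotheses [HQ], [HP] and [HW] say that a step reproduces the constants,
    [C0] paying for the passage from [g k] to [g k.+1]; [HG] keeps the mean loss below [eta / 2] at
    all scales. *)
Lemma scale_estimates k : (r * k.+1 <= n)%N -> forall x,
  [/\ Prob (fun w => ~~ Tied k x w) <= Q * g k, Prob (Light k x) <= P * g k,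
      Exp (Loss k x) <= (P + Q) * \sum_(i < k) g i & Var (Loss k x) <= W * g k].
Proof.
elim: k => [_|k IH kn] x.
  have tied0 w : Tied 0 x w.
    apply/tiedP => y z; rewrite !in_setI muln0 hball0 !in_set1.
    by move=> /andP[_ /eqP ->] /andP[_ /eqP ->]; exact: connect0.
  have core0 w : Core 0 w :&: B 0 x = [set x] by rewrite muln0 hball0 setTI.
  have light0 w : Light 0 x w = false.
    rewrite /light /light_in core0 cards1 muln0 expr0 mulr1; apply/negbTE.
    by rewrite -leNgt lerBlDr lerDl ltW.
  have loss0 w : Loss 0 x w = 0.
    by rewrite /loss light0 core0 cards1 muln0 expr0 divr1 subrr.
  have Eloss0 : Exp (Loss 0 x) = 0 by rewrite (eq_Ex J loss0) Ex_cst.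
  split.
  - rewrite (_ : Prob _ = 0); first by rewrite mulr_ge0.
    by rewrite -(Ex_cst d L n J 0); apply: eq_Ex => w; rewrite tied0.
  - rewrite (_ : Prob _ = 0); first by rewrite mulr_ge0.
    by rewrite -(Ex_cst d L n J 0); apply: eq_Ex => w; rewrite light0.
  - by rewrite Eloss0 big_ord0 mulr0.
  - rewrite /var Eloss0 (_ : Exp _ = 0); first by rewrite mulr_ge0.
    by rewrite -[RHS](Ex_cst d L n J 0); apply: eq_Ex => w; rewrite loss0 subrr expr0n.
have kn1 : (r * k.+1 <= n)%N by rewrite (leq_trans _ kn)// leq_mul2l leqnSn orbT.
have {}IH := IH kn1.
have tq y : Prob (fun w => ~~ Tied k y w) <= Q * g k by case: (IH y).
have lp y : Prob (Light k y) <= P * g k by case: (IH y).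
have lm y : Exp (Loss k y) <= (P + Q) * \sum_(i < k) g i by case: (IH y).
have lv y : Var (Loss k y) <= W * g k by case: (IH y).
have PQ0 : 0 <= P + Q by rewrite addr_ge0.
have m_eta : (P + Q) * \sum_(i < k) g i <= eta / 2.
  by apply: le_trans HG; rewrite ler_wpM2l.
have bad y : Prob (fun w => ~~ Good k y w) <= (P + Q) * g k.
  rewrite mulrDl; apply: le_trans (lerD (lp y) (tq y)).
  apply: le_trans (PrU J_ge0 _ _); apply: (le_Pr J_ge0) => w.
  by rewrite /good negb_and negbK.
(* Lightness at scale [k.+1] is estimated first, from scale [k] alone, because it enters the mean
   and the variance of the loss at scale [k.+1]. *)
have light_next : Prob (Light k.+1 x) <= P * g k.+1.
  apply: le_trans (Pr_light_next L2 d1 J_ge0 eta01 x kn1 tq lm m_eta lv) _.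
  rewrite [_ * (W * _)]mulrA [_ * (Q * _)]mulrA -mulrDl; apply: step => //.
  by rewrite addr_ge0// mulr_ge0// divr_ge0 ?mulr_ge0 ?exprn_ge0 ?(ltW N_gt0) ?(ltW eta0).
have M0 : 0 < M by rewrite exprn_gt0.
have unitsE : #|@units d L n r k x| = (((L ^ d) ^ r) ^ 2)%N.
  by apply/eqP; rewrite -(eqr_nat R) (card_units R L2 d1 x kn) !natrX.
have h0 : 0 <= h := le_trans (expR_ge0 _) (lc_h 0).
split => //.
- have := @Pr_loose R d L n J L2 d1 J_ge0 r eta eta01 k x (lc k) ((P + Q) * g k) kn M3
    (lc_ge0 k) (J_lb (k := k)) bad.
  move=> /le_trans; apply; rewrite unitsE.
  have S0 : 0 <= K1 + M ^+ 6 * h * (P + Q) + (P + Q) ^+ 2 * tau.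
    have tau0 : 0 <= tau := le_trans (g_ge0 0) (g_tau 0).
    by rewrite !addr_ge0// !mulr_ge0 ?sqr_ge0// exprn_ge0// ltW.
  apply: le_trans (step k S0 HQ); rewrite [leRHS]mulrDl [X in _ <= X + _]mulrDl; apply: lerD; first apply: lerD.
  - by rewrite ler_wpM2l.
  - rewrite (_ : M ^+ 6 * h * (P + Q) * g k = M ^+ 2 * ((P + Q) * g k) * (M ^+ 4 * h)).
      by rewrite !(ler_wpM2l, mulr_ge0)// exprn_ge0// ltW.
    by ring.
  - rewrite exprMn [g k ^+ 2]expr2 mulrA ler_wpM2r// ler_wpM2l ?sqr_ge0//.
- apply: le_trans (Ex_loss_next L2 d1 J_ge0 kn1 tq lm light_next) _.
  rewrite big_ord_recr/= mulrDr -addrA lerD2l [leRHS]mulrDl addrC lerD2r.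
  by rewrite ler_wpM2l.
- apply: le_trans (var_loss_next L2 d1 J_ge0 kn1 tq lv light_next) _.
  rewrite (_ : 2 / M * (W * g k) + 2 * (Q * g k + P * g k.+1) =
    (2 / M * W + 2 * Q) * g k + 2 * P * g k.+1); last by ring.
  apply: le_trans (ler_wpM2r (g_ge0 k.+1) HW); rewrite [leRHS]mulrDl lerD2r.
  apply: step => //; by rewrite addr_ge0 ?mulr_ge0// invr_ge0 ltW.
Qed.

(** The origin drops out of the cores with total probability at most [(P + Q) * G], so it lies in
    the core of scale [k.+1] with probability at least 1/2. It is then connected to the core of its
    ball of scale [k], which occupies at least half of that ball. *)
Lemma origin_cluster_large k m : n = (r * k.+1)%N -> eta <= 1 / 2 ->
  (m.*2 <= (L ^ d) ^ (r * k))%N ->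
  1 / 2 <= prob_cluster_ge d L J n m.
Proof.
move=> nE eta2 mN; set o := origin d n L2.
have kn : (r * k.+1 <= n)%N by rewrite nE.
have kn0 : (r * k <= n)%N by rewrite (leq_trans _ kn)// leq_mul2l leqnSn orbT.
have not_core : forall j, (j <= k.+1)%N ->
    Prob (fun w => o \notin Core j w) <= (P + Q) * \sum_(i < j) g i.
  elim=> [_|j IH jk].
    rewrite big_ord0 mulr0 (_ : Prob _ = 0)// -(Ex_cst d L n J 0).
    by apply: eq_Ex => w; rewrite in_setT.
  have jn : (r * j.+1 <= n)%N by rewrite nE leq_mul2l jk orbT.
  have [tq lp _ _] := scale_estimates jn o.
  rewrite big_ord_recr/= mulrDr; apply: (@le_trans _ _ (Prob (fun w => (o \notin Core j w) || ~~ Good j o w))).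
    by apply: (le_Pr J_ge0) => w; rewrite in_coreS negb_and.
  apply: le_trans (PrU J_ge0 _ _) _; apply: lerD; first by rewrite IH// ltnW.
  rewrite mulrDl; apply: le_trans (lerD lp tq).
  apply: le_trans (PrU J_ge0 _ _); apply: (le_Pr J_ge0) => w.
  by rewrite /good negb_and negbK.
have PQ0 : 0 <= P + Q by rewrite addr_ge0.
have core_ge : 1 / 2 <= Prob (fun w => o \in Core k.+1 w).
  have hin : Prob (fun w => o \notin Core k.+1 w) <= eta / 2.
    by apply: le_trans (not_core _ (leqnn _)) (le_trans _ HG); rewrite ler_wpM2l.
  have := PrC J (fun w => o \in Core k.+1 w).
  rewrite (_ : Pr J (predC _) = Prob (fun w => o \notin Core k.+1 w)); last exact: eq_Pr.
  by move: hin; move: (Prob _) (Prob _) => u v; lra.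
apply: le_trans core_ge _; rewrite prob_cluster_geE; apply: (le_Pr J_ge0) => w.
rewrite in_coreS /good => /and3P[oc ol /tiedP ot].
have sub : Core k w :&: B k o \subset Defs.cluster w.
  apply/subsetP => y yG; rewrite (in_cluster L2).
  apply: connect_sub (ot o y _ yG); last by rewrite in_setI oc hball_refl.
  by move=> u v /and4P[_ _ _ uv]; exact: connect1.
apply: leq_trans (subset_leq_card sub).
rewrite -(ler_nat R); move: ol; rewrite /light /light_in -leNgt; apply: le_trans.
have : m.*2%:R <= N ^+ (r * k) by rewrite -[N ^+ _]natrX ler_nat.
rewrite -mul2n natrM => mN'.
have NN : 0 < N ^+ (r * k) by rewrite exprn_gt0.
nra.
Qed.

End SupercriticalInduction.

(** * The percolating kernel and the choice of the constants *)

Section SupercriticalKernel.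
Variables (R : realType) (d L : nat).
Hypothesis L2 : (2 <= L)%N.
Hypothesis d1 : (1 <= d)%N.
Notation N := ((L ^ d)%N%:R : R).

Let N_ge2 : 2 <= N. Proof. exact: N_ge2. Qed.
Let N_gt0 : 0 < N. Proof. exact: lt_le_trans N_ge2. Qed.

(** Comparison with an integral in telescoped form: [y ^ (- b) <= (z ^ (- s) - y ^ (- s)) / s] with
    [z = y - 1] and [s = b - 1]. *)
Lemma sum_powR_le (b : R) k : 1 < b ->
  \sum_(i < k) i.+1%:R `^ (- b) <= 1 + (b - 1)^-1.
Proof.
move=> b1; set s := b - 1; have s0 : 0 < s by rewrite subr_gt0.
have si0 : 0 < s^-1 by rewrite invr_gt0.
case: k => [|k]; first by rewrite big_ord0 addr_ge0// ltW.
suff : \sum_(i < k.+1) i.+1%:R `^ (- b) <= 1 + s^-1 - s^-1 * k.+1%:R `^ (- s).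
  by move=> /le_trans; apply; rewrite gerBl mulr_ge0 ?powR_ge0// ltW.
elim: k => [|k IH]; first by rewrite big_ord_recl big_ord0 addr0 powR1 mulr1 addrK.
rewrite big_ord_recr/=; apply: le_trans (lerD IH (lexx _)) _.
set y : R := k.+2%:R; have y0 : 0 < y by rewrite ltr0n.
set z : R := k.+1%:R; have z0 : 0 < z by rewrite ltr0n.
have yz : z = y - 1 by rewrite /y -[k.+2%:R]natr1 addrK.
have pE (u p : R) : 0 < u -> u `^ p = expR (p * ln u) by move=> u0; rewrite /powR gt_eqF.
have lnz : ln z <= ln y - y^-1.
  rewrite -ler_expR expRD !lnK ?posrE// yz.
  have := ler_wpM2l (ltW y0) (expR_ge1Dx (- y^-1)).
  by rewrite mulrDr mulr1 mulrN divff ?gt_eqF.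
have T : y `^ (- b) = y `^ (- s) * y^-1.
  by rewrite !pE// -[y^-1]lnK ?posrE ?invr_gt0// -expRD lnV ?posrE//; congr expR; rewrite /s; ring.
have zy : y `^ (- s) * (1 + s / y) <= z `^ (- s).
  rewrite !pE//; apply: (@le_trans _ _ (expR (- s * ln y) * expR (s / y))).
    by rewrite ler_wpM2l ?expR_ge0// expR_ge1Dx.
  rewrite -expRD ler_expR; have := ler_wpM2l (ltW s0) lnz.
  by move: (ln y) (ln z) (y^-1) => A B C; nra.
rewrite T; move: (y `^ (- s)) (z `^ (- s)) zy => u v zy.
have := ler_wpM2l (ltW si0) zy.
rewrite (_ : s^-1 * (u * (1 + s / y)) = s^-1 * u + u / y); last by field; rewrite !gt_eqF.
by move: (s^-1) (y^-1) => si yi; nra.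
Qed.

Lemma perc_prob_gt0 (J : nat -> R) (c : R) : 0 < c ->
  (forall k, (1 <= k)%N -> 0 <= J (L ^ k)%N) ->
  (forall m, exists n, c <= prob_cluster_ge d L J n m) -> 0 < perc_prob d L J.
Proof.
move=> c0 J0 large; apply: (lt_le_trans c0).
pose A m : set R := [set p | exists n : nat, p = prob_cluster_ge d L J n m]%classic.
have ne : ([set s | exists m, s = sup (A m)] !=set0)%classic by exists (sup (A 0%N)), 0%N.
apply: (lb_le_inf ne) => _ [m ->]; have [n cn] := large m; apply: le_trans cn _.
have ubA : has_ubound (A m).
  by exists 1 => _ [n' ->]; rewrite prob_cluster_geE Pr_le1.
exact: (ub_le_sup ubA (ex_intro _ n erefl)).
Qed.

(** At length [L ^ k], [trunc_log] recovers the level [k]. The factor [lam] preserves the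
    asymptotics and makes failures unlikely from the first scales on. *)
Definition loglog_kernel (a lam : R) (m : nat) : R :=
  a * L%:R ^+ d * m%:R ^- (2 * d) * ln (lam * (trunc_log L m)%:R).

Variables (a : R).
Hypothesis a1 : 1 < a.

Lemma loglog_kernelE lam k :
  loglog_kernel a lam (L ^ k)%N = a * (N / N ^+ (2 * k)) * ln (lam * k%:R).
Proof.
have -> : N ^+ (2 * k) = (L ^ k)%N%:R ^+ (2 * d).
  by rewrite !natrX -!exprM; congr (_ ^+ _); rewrite mulnCA [RHS]mulnCA (mulnC d).
by rewrite /loglog_kernel trunc_expnK// [(L ^ d)%N%:R]natrX mulrA.
Qed.

Lemma loglog_kernel_ge0 lam : 1 <= lam -> forall k, (1 <= k)%N ->
  0 <= loglog_kernel a lam (L ^ k)%N.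
Proof.
move=> lam1 k k1; rewrite loglog_kernelE mulr_ge0//.
  by rewrite mulr_ge0 ?divr_ge0 ?exprn_ge0 ?(ltW N_gt0)// (le_trans ler01)// ltW.
by rewrite ln_ge0// mulr_ege1// ler1n.
Qed.

(** The logarithms in numerator and denominator differ by the constant [D], while the denominator
    tends to infinity. *)
Lemma loglog_kernel_asymp lam : 1 <= lam ->
  ((fun k : nat => loglog_kernel a lam (L ^ k)%N /
    (a * (L%:R) ^+ d * ((L ^ k)%N%:R) ^- (2 * d) * ln (ln ((L ^ k)%N%:R))))
    @ \oo --> (1 : R))%classic.
Proof.
move=> lam1; have lam0 : 0 < lam by rewrite (lt_le_trans ltr01).
have lnL : 0 < ln (L%:R : R) by rewrite ln_gt0// ltr1n.
pose D := ln lam - ln (ln (L%:R : R)).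
apply/cvgrPdist_le => e e0.
pose X := expR (`|D| / e + 1) / ln (L%:R : R).
exists (maxn 1 (Num.bound X)) => // k /=; rewrite geq_max => /andP[k1 kX].
have k0 : 0 < k%:R :> R by rewrite ltr0n.
have Xk : X <= k%:R.
  apply: (le_trans (ltW (archi_boundP _))); first by rewrite divr_ge0 ?expR_ge0// ltW.
  by rewrite ler_nat.
have le_ln : `|D| / e + 1 <= ln (k%:R * ln (L%:R : R)).
  by rewrite -ler_expR lnK ?posrE ?mulr_gt0// -ler_pdivrMr.
have De : 0 <= `|D| / e by rewrite divr_ge0// ltW.
have l0 : 0 < ln (k%:R * ln (L%:R : R)) by lra.
rewrite ln_LX// /loglog_kernel trunc_expnK//.
set Y := a * _ * _; have Y0 : Y != 0.
  rewrite !mulf_neq0// ?invr_neq0 ?expf_neq0 ?pnatr_eq0 -?lt0n ?expn_gt0 ?(ltnW L2)//.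
  by rewrite gt_eqF// (lt_trans ltr01).
rewrite (_ : _ / _ = ln (lam * k%:R) / ln (k%:R * ln L%:R)); last first.
  by field; rewrite Y0 gt_eqF.
have -> : ln (lam * k%:R) = ln (k%:R * ln (L%:R : R)) + D.
  by rewrite !lnM ?posrE// /D; ring.
rewrite mulrDl divff ?gt_eqF// opprD addrA subrr add0r normrN normrM normfV.
rewrite (gtr0_norm l0) ler_pdivrMr//.
have : `|D| <= e * (`|D| / e + 1) by rewrite mulrDr mulrCA divff ?gt_eqF// mulr1 mulr1 lerDl ltW.
by move=> /le_trans; apply; rewrite ler_wpM2l// ltW.
Qed.

Lemma powRN_anti (x y p : R) : 0 <= p -> 0 < x -> x <= y -> y `^ (- p) <= x `^ (- p).
Proof.
move=> p0 x0 xy; have y0 := lt_le_trans x0 xy.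
by rewrite !powRN lef_pV2 ?posrE ?powR_gt0// ge0_ler_powR// nnegrE ltW.
Qed.

(** With [eta = (a - 1) / (8 * a)] and [1 / M <= eta], the exponent is at least
    [(1 - 3 * eta) * a = a - 3 * (a - 1) / 8], which exceeds 1. The lower bound on [M] lets the
    averaging over units beat the factors [2 ^ a] and [1 / eta ^ 2] of the recursion. *)
Lemma supercritical_parameters : exists (eta : R) (r : nat), let M := N ^+ r in
  [/\ 0 < eta <= 1 / 8, (0 < r)%N, 3 <= M, 256 * 2 `^ a / eta ^+ 2 <= M &
      1 < (1 - eta) ^+ 2 * (1 - M^-1) * a].
Proof.
have a0 : 0 < a by rewrite (lt_trans ltr01).
pose eta := (a - 1) / (8 * a).
have eta0 : 0 < eta by rewrite divr_gt0 ?mulr_gt0// subr_gt0.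
have eta8 : eta <= 1 / 8 by rewrite ler_pdivrMr ?mulr_gt0//; lra.
have aeta : a * eta = (a - 1) / 8 by rewrite /eta; field; rewrite gt_eqF.
have p1 : 1 <= 2 `^ a by rewrite -[leLHS](powRr0 2) ler_powR ?ler1n// ltW.
pose u := 2 `^ a / eta ^+ 2.
have u_eta : eta^-1 <= u.
  apply: (@le_trans _ _ (eta ^+ 2)^-1); last by rewrite /u ler_peMl// invr_ge0 sqr_ge0.
  rewrite lef_pV2 ?posrE ?exprn_gt0//.
  by rewrite expr2 ler_piMl ?(ltW eta0)//; lra.
have u8 : 8 <= u.
  by apply: le_trans u_eta; rewrite -[8]invrK lef_pV2 ?posrE ?invr_gt0//; lra.
pose X := 256 * u.
exists eta, (Num.bound X); set r := Num.bound X; set M := N ^+ r.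
have Xr : X < r%:R by rewrite archi_boundP// /X; lra.
have XM : X <= M.
  apply: le_trans (ltW Xr) _; apply: (@le_trans _ _ (2 ^+ r)).
    by rewrite -natrX ler_nat ltnW// ltn_expl.
  by rewrite /M lerXn2r ?nnegrE ?(ltW N_gt0).
have M0 : 0 < M by rewrite exprn_gt0.
have Meta : M^-1 <= eta.
  rewrite -[eta]invrK lef_pV2 ?posrE ?invr_gt0//; apply: le_trans XM; apply: le_trans u_eta _.
  by rewrite /X; lra.
split => //.
- by rewrite eta0.
- by move: XM; rewrite /X; lra.
- by rewrite -mulrA.
have M1 : 0 <= M^-1 by rewrite invr_ge0 ltW.
have h1 : (1 - 2 * eta) * (1 - eta) <= (1 - eta) ^+ 2 * (1 - M^-1).
  by apply: ler_pM; [lra|lra|nra|lra].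
have h2 : 1 - 3 * eta <= (1 - 2 * eta) * (1 - eta) by nra.
have h3 : (1 - 3 * eta) * a = a - 3 * ((a - 1) / 8) by rewrite -aeta; ring.
by apply: lt_le_trans (ler_wpM2r (ltW a0) (le_trans h2 h1)); rewrite h3 /=; move: a1; rewrite -subr_gt0; lra.
Qed.

Lemma supercritical_perc_prob_gt0 : exists2 lam, 1 <= lam & 0 < perc_prob d L (loglog_kernel a lam).
Proof.
have a0 : 0 < a by rewrite (lt_trans ltr01).
have [eta [r [/andP[eta0 eta8] r0 M3 MX b1]]] := supercritical_parameters.
set M := N ^+ r in M3 MX b1.
have M0 : 0 < M by lra.
set b := (1 - eta) ^+ 2 * (1 - M^-1) * a in b1.
set c1 := (1 - eta) ^+ 2 * (N / M ^+ 4) * a.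
have eta1 : 0 < 1 - eta by lra.
have c10 : 0 < c1 by rewrite !mulr_gt0 ?invr_gt0 ?exprn_gt0.
have b0 : 0 < b by lra.
have Mi : 0 < M^-1 <= 1 by rewrite invr_gt0 M0 invf_le1//; lra.
have ba : b <= a.
  rewrite /b ler_piMl ?(ltW a0)//; case/andP: Mi => ? ?.
  apply: mulr_ile1; [exact: sqr_ge0|lra|rewrite expr_le1//; lra|lra].
(* [C0] will bound the ratio of [g k] to [g k.+1], which is at most [2 ^ b] with [b <= a]. *)
pose C0 : R := 2 `^ a; have C01 : 1 <= C0 by rewrite -[leLHS](powRr0 2) ler_powR ?ler1n// ltW.
have C00 : 0 < C0 by lra.
pose K1 : R := 2 ^+ (((L ^ d) ^ r) ^ 2)%N.
have K10 : 0 < K1 by rewrite exprn_gt0.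
(* [Q] is twice the cut term, the second half being kept for the terms with [ep]. [P] is what the
   lightness estimate requires, and half of [W] pays for the multiples of [C0 * Q / eta] in the
   variance recursion. *)
pose Q := 2 * C0 * K1; have Q0 : 0 < Q by rewrite !mulr_gt0.
pose W := 20 * C0 * Q / eta; have W0 : 0 < W by rewrite divr_gt0 ?mulr_gt0.
pose P := W / 16 + 4 * C0 * Q / eta.
have P0 : 0 < P by rewrite addr_gt0 ?divr_gt0 ?mulr_gt0.
have PQ0 : 0 < P + Q by rewrite addr_gt0.
pose Z := 1 + (b - 1)^-1.
have Z0 : 0 < Z by rewrite addr_gt0 ?invr_gt0 ?subr_gt0.
pose S := M ^+ 6 * (P + Q) + (P + Q) ^+ 2.
have S0 : 0 < S by rewrite addr_gt0 ?mulr_gt0 ?exprn_gt0.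
(* [ep] is chosen after [eta], [r], [Q], [W] and [P], and [lam] after [ep]; none of the earlier
   constants involves [lam], so there is no circularity. *)
pose ep := Num.min 1 (Num.min (K1 / S) (eta / 2 / ((P + Q) * Z))).
have ep0 : 0 < ep by rewrite !lt_min ltr01 !divr_gt0 ?mulr_gt0.
have ep1 : ep <= 1 by rewrite ge_min lexx.
have epS : ep * S <= K1 by rewrite -ler_pdivlMr// !ge_min lexx !orbT.
have epZ : ep * ((P + Q) * Z) <= eta / 2.
  by rewrite -ler_pdivlMr ?mulr_gt0// !ge_min lexx !orbT.
pose c := Num.min c1 b; have c0 : 0 < c by rewrite lt_min c10.
(* With this value [lam ^ (- p) <= ep] for all [p >= c], hence for both exponents [b] and [c1]. *)
pose lam := ep `^ (- c^-1).
have lamp p : c <= p -> lam `^ (- p) <= ep.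
  move=> cp; rewrite /lam -powRrM mulrNN mulrC -[leRHS]powRr1 ?(ltW ep0)//.
  by rewrite ger_powR ?ep0// ler_pdivlMr// mul1r.
have lam1 : 1 <= lam.
  by rewrite /lam -[leLHS](powRr0 ep) ger_powR ?ep0// oppr_le0 invr_ge0 ltW.
have lam0 : 0 < lam by lra.
exists lam => //.
pose J := loglog_kernel a lam.
have J0 := loglog_kernel_ge0 lam1.
pose lc k := a * ln (lam * k.+1%:R).
pose g k := lam `^ (- b) * k.+1%:R `^ (- b).
have k1 k : 0 < k.+1%:R :> R by rewrite ltr0n.
have lamk k : 1 <= lam * k.+1%:R by rewrite mulr_ege1// ler1n.
have lexp k s : expR (- (s * lc k)) = (lam * k.+1%:R) `^ (- (s * a)).
  rewrite /powR gt_eqF ?mulr_gt0//; congr expR; rewrite /lc; ring.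
have gE k : g k = (lam * k.+1%:R) `^ (- b).
  by rewrite /g powRM ?(ltW lam0) ?(ltW (k1 k)).
have bge : c <= b by rewrite ge_min lexx orbT.
have cge : c <= c1 by rewrite ge_min lexx.
apply: (@perc_prob_gt0 J (1 / 2)) => // m.
(* Scale [m.*2] is large enough because [N ^ (r * m.*2)] is at least [2 ^ m.*2], hence at least
   [m.*2]. The extra scale is the one at which ties are looked for. *)
exists (r * (m.*2).+1)%N.
have eta01 : 0 < eta < 1 by rewrite eta0; lra.
have lc_ge0 k : 0 <= lc k by rewrite mulr_ge0 ?ln_ge0// ltW.
have J_lb k l : (r * k < l)%N -> lc k * (N / N ^+ (2 * l)) <= J (L ^ l)%N.
  move=> rkl; rewrite /J loglog_kernelE /lc mulrAC ler_wpM2l//.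
    by rewrite mulr_ge0 ?(ltW a0)// divr_ge0 ?exprn_ge0 ?(ltW N_gt0).
  have kl : (k < l)%N by rewrite (leq_ltn_trans _ rkl)// leq_pmull.
  rewrite ler_ln ?posrE ?mulr_gt0 ?ltr0n ?(leq_ltn_trans (leq0n k) kl)//.
  by rewrite ler_wpM2l ?(ltW lam0)// ler_nat.
have g_ge0 k : 0 <= g k by rewrite mulr_ge0 ?powR_ge0.
have g_next k : g k <= C0 * g k.+1.
  rewrite /g mulrCA ler_wpM2l ?powR_ge0//.
  apply: (@le_trans _ _ (2 `^ b * (2 * k.+1%:R) `^ (- b))).
    rewrite powRM// ?(ltW (k1 k))// mulrA -powRD ?subrr ?powRr0 ?mul1r//.
    by apply/implyP.
  apply: ler_pM; rewrite ?powR_ge0//; first by rewrite ler_powR ?ler1n.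
  apply: powRN_anti (ltW b0) (k1 _) _.
  by rewrite -natrM ler_nat mul2n -addnn addSn addnS !ltnS leq_addl.
have g_mono k : g k.+1 <= g k.
  rewrite /g ler_wpM2l ?powR_ge0//; apply: powRN_anti (ltW b0) (k1 _) _.
  by rewrite ler_nat.
have g_tau k : g k <= ep.
  rewrite /g -[leRHS]mulr1 ler_pM ?powR_ge0 ?lamp//.
  have one : 1 `^ (- b) = 1 :> R by rewrite powR1.
  by rewrite -[leRHS]one powRN_anti ?(ltW b0)// ler1n.
have g_sum k : \sum_(i < k) g i <= ep * Z.
  rewrite -mulr_sumr ler_pM ?powR_ge0 ?lamp ?sum_powR_le//.
  by apply: sumr_ge0 => i _; rewrite powR_ge0.
have lc_g k : expR (- ((1 - eta) ^+ 2 * (1 - M^-1) * lc k)) <= g k.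
  by rewrite lexp gE.
have lc_h k : expR (- ((1 - eta) ^+ 2 * (N / M ^+ 4) * lc k)) <= ep.
  rewrite lexp -/c1; apply: le_trans (lamp c1 cge).
  apply: (powRN_anti (ltW c10) lam0).
  by apply: ler_peMr (ltW lam0) _; rewrite ler1n.
have HQ : C0 * (K1 + M ^+ 6 * ep * (P + Q) + (P + Q) ^+ 2 * ep) <= Q.
  rewrite (_ : K1 + _ + _ = K1 + ep * S); last by rewrite /S; ring.
  rewrite /Q (_ : 2 * C0 * K1 = C0 * (K1 + K1)); last by ring.
  by rewrite ler_wpM2l ?(ltW C00)// lerD2l.
have e20 : 0 < eta ^+ 2 by rewrite exprn_gt0.
have MC : 256 * C0 <= M * eta ^+ 2 by rewrite -ler_pdivrMr.
have eta2le : eta ^+ 2 <= 1 by rewrite expr_le1//; lra.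
have M256 : 256 * C0 <= M.
  by apply: le_trans MC _; rewrite ler_piMr// ltW.
have Q1 : 0 < C0 * Q by rewrite mulr_gt0.
have Qeta : C0 * Q <= C0 * Q / eta by rewrite ler_peMr ?(ltW Q1)// invf_ge1//; lra.
have HP : C0 * (16 / (M * eta ^+ 2) * W + 4 / eta * Q) <= P.
  rewrite (_ : C0 * _ = C0 * 16 / (M * eta ^+ 2) * W + 4 * C0 * Q / eta); last first.
    by field; rewrite !gt_eqF.
  rewrite /P lerD2r mulrC ler_wpM2l ?(ltW W0)// ler_pdivrMr ?mulr_gt0//; lra.
have HW : C0 * (2 / M * W + 2 * Q) + 2 * P <= W.
  have h1 : C0 * (2 / M * W) <= W / 128.
    rewrite (_ : C0 * _ = W * (2 * C0 / M)); last by ring.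
    by rewrite ler_wpM2l ?(ltW W0)// ler_pdivrMr//; lra.
  have WE : W = 20 * (C0 * Q / eta) by rewrite /W; ring.
  have PE : P = W / 16 + 4 * (C0 * Q / eta) by rewrite /P; ring.
  by rewrite mulrDr PE; move: h1 Qeta WE; move: (C0 * Q / eta) => u; lra.
have HG : (P + Q) * (ep * Z) <= eta / 2 by rewrite mulrCA.
apply: (@origin_cluster_large R d L _ J L2 d1 J0 r eta eta01 M3 lc g C0 Q P W ep ep (ep * Z)
  lc_ge0 J_lb g_ge0 g_next g_mono g_tau g_sum lc_g lc_h (ltW Q0) (ltW P0) (ltW W0)
  HQ HP HW HG (m.*2)) => //; first by lra.
apply: (@leq_trans (2 ^ m.*2)); first by rewrite ltnW// ltn_expl.
apply: (@leq_trans ((L ^ d) ^ m.*2)).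
  by case: (m.*2) => // j; rewrite leq_exp2r//; have := N_ge2; rewrite ler_nat.
by rewrite leq_pexp2l ?expn_gt0 ?(ltnW L2)// leq_pmull.
Qed.

End SupercriticalKernel.

Local Open Scope classical_set_scope.
Local Open Scope ring_scope.

Theorem theorem1p3 (R : realType) (d L : nat) (hd : (1 <= d)%N) (hL : (2 <= L)%N) :
  (* (i) *)
  (forall a : R, 1 < a ->
     exists J : nat -> R,
       (forall k : nat, (1 <= k)%N -> 0 <= J (L ^ k)%N) /\
       ((fun k : nat =>
           J (L ^ k)%N /
           (a * (L%:R) ^+ d * ((L ^ k)%N%:R) ^- (2 * d) * ln (ln ((L ^ k)%N%:R))))
          @ \oo --> (1 : R)) /\
       0 < perc_prob d L J) /\
  (* (ii) *)
  (forall J : nat -> R,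
     (forall k : nat, (1 <= k)%N -> 0 <= J (L ^ k)%N) ->
     (limn_esup (fun n : nat =>
        ((L%:R) ^- d * ((L ^ n)%N%:R) ^+ (2 * d) / ln (ln ((L ^ n)%N%:R))
           * J (L ^ n)%N)%:E) <= 1%:E)%E ->
     perc_prob d L J = 0).
Proof.
split=> [a a1|J J_ge0 J_limsup]; last exact: subcritical_perc_prob_eq0.
have [lam lam1 perc] := supercritical_perc_prob_gt0 hL hd a1.
exists (loglog_kernel d L a lam); split; first exact: loglog_kernel_ge0.
by split=> //; exact: loglog_kernel_asymp.
Qed.
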